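(* Let $4.2$ denote the $3$-graph on $4$ vertices with exactly $2$ edges, $K_4^-$ the $3$-graph on $4$ vertices with exactly $3$ edges, and $F_{3,2}$ the $3$-graph on $\{1,\dots,5\}$ with edges $123,124,125,345$. Then \[\pi_{4.2}(\{K_4^-,F_{3,2}\})=\frac{5}{9}.\]
   Context: A $3$-graph is a pair $G=(V,E)$ with $E$ a set of $3$-element subsets of $V$. For a $3$-graph $H$ on $h$ vertices and a $3$-graph $G$ on $n\ge h$ vertices, $e_H(G)$ is the number of $h$-subsets of $V(G)$ inducing a subgraph isomorphic to $H$. For a family $\mathcal{F}$ of $3$-graphs, $G$ is $\mathcal{F}$-free if it contains no member of $\mathcal{F}$ as a (not necessarily induced) subgraph. $\mathrm{ex}_H(n,\mathcal{F})$ is the maximum of $e_H(G)$ over $\mathcal{F}$-free $G$ on $n$ vertices, and $\pi_H(\mathcal{F})=\lim_{n\to\infty}\mathrm{ex}_H(n,\mathcal{F})/\binom{n}{h}$ (the limit exists). *)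

(* Defs.v *)
From HB Require Import structures.
From mathcomp Require Import all_boot all_order all_algebra.
From mathcomp Require Import all_classical all_reals all_analysis.

Set Implicit Arguments.
Unset Strict Implicit.
Unset Printing Implicit Defensive.

Import Order.TTheory GRing.Theory Num.Theory.
Import numFieldNormedType.Exports.

Definition uniform3 (V : finType) (E : {set {set V}}) : bool :=
  [forall (e | e \in E), #|e| == 3].

Record graph3 (V : finType) := Graph3 {
  edges :> {set {set V}};
  edges_uniform3 : uniform3 edges
}.

HB.instance Definition _ (V : finType) := [isSub for @edges V].
HB.instance Definition _ (V : finType) := [Finite of graph3 V by <:].

Definition isomorphic (V W : finType) (G : graph3 V) (H : graph3 W) : Prop :=
  exists2 f : V -> W, bijective f &
    forall e : {set V}, (f @: e \in edges H) = (e \in edges G).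

Definition contains (V W : finType) (G : graph3 V) (F : graph3 W) : Prop :=
  exists2 f : W -> V, injective f &
    forall e : {set W}, e \in edges F -> f @: e \in edges G.

Section Induced.
Variables (V : finType) (G : graph3 V) (S : {set V}).

Definition induced_edges : {set {set {x : V | x \in S}}} :=
  [set e : {set {x : V | x \in S}} | [set val x | x in e] \in edges G].

Fact induced_uniform3 : uniform3 induced_edges.
Proof.
apply/forallP => e; apply/implyP; rewrite inE => eG.
rewrite -(card_imset _ val_inj).
exact: (implyP (forallP (edges_uniform3 G) _) eG).
Qed.

Definition induced : graph3 {x : V | x \in S} := Graph3 induced_uniform3.
End Induced.

(* e_H(G) *)
Definition induced_count (V W : finType) (H : graph3 W) (G : graph3 V) : nat :=
  #|[set S : {set V} | (#|S| == #|W|) && `[< isomorphic (induced G S) H >]]|.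

(* Families consist of 3-graphs on vertex sets {0, ..., k - 1}, so that they
   are sets in a fixed type; every finite 3-graph is isomorphic to such one. *)
Definition fingraph3 := {k : nat & graph3 'I_k}.

Definition pack3 (k : nat) (F : graph3 'I_k) : fingraph3 :=
  existT (fun k => graph3 'I_k) k F.

Definition is_free (V : finType) (Fam : set fingraph3) (G : graph3 V) : Prop :=
  forall F : fingraph3, Fam F -> ~ contains G (projT2 F).

(* ex_H(n, Fam) *)
Definition ex (W : finType) (H : graph3 W) (n : nat) (Fam : set fingraph3)
    : nat :=
  \max_(G : graph3 'I_n | `[< is_free Fam G >]) induced_count H G.

(* For n < #|W| the denominator is 0 and the term is the junk value 0. *)
Definition density (R : realType) (W : finType) (H : graph3 W)
    (Fam : set fingraph3) (n : nat) : R :=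
  ((ex H n Fam)%:R / 'C(n, #|W|)%:R)%R.

(* pi_H(Fam) *)
Definition turan_density (R : realType) (W : finType) (H : graph3 W)
    (Fam : set fingraph3) : R :=
  limn (density R H Fam).

Definition vset (k : nat) (s : seq nat) : {set 'I_k} :=
  [set x : 'I_k | val x \in s].

Definition list_edges (k : nat) (l : seq (seq nat)) : {set {set 'I_k}} :=
  [set e : {set 'I_k} | e \in [seq vset k s | s <- l]].

Fact list_edges_uniform3 k l :
  all (fun s => [&& uniq s, size s == 3 & all (fun i => i < k) s]) l ->
  uniform3 (list_edges k l).
Proof.
move=> /allP ok; apply/forallP => e; apply/implyP; rewrite inE.
case/mapP => s /ok /and3P[us /eqP <- /allP sk] ->; apply/eqP.
have -> : #|vset k s| = size [seq val x | x <- enum (vset k s)].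
  by rewrite size_map -cardE.
apply/perm_size/uniq_perm => //.
  by rewrite map_inj_uniq ?enum_uniq//; exact: val_inj.
move=> i; apply/mapP/idP => [[x]|si].
  by rewrite mem_enum inE => xs ->.
by exists (Ordinal (sk _ si)) => //; rewrite mem_enum inE.
Qed.

(* Two 3-graphs on 4 vertices with equally many edges are isomorphic, so fixing
   the edges of 4.2 and K_4^- loses no generality. *)
Definition g42 : graph3 'I_4 :=
  Graph3 (@list_edges_uniform3 4 [:: [:: 0; 1; 2]; [:: 0; 1; 3]] isT).

Definition K4minus : graph3 'I_4 :=
  Graph3 (@list_edges_uniform3 4
    [:: [:: 0; 1; 2]; [:: 0; 1; 3]; [:: 0; 2; 3]] isT).

(* The vertices 1, ..., 5 are renumbered 0, ..., 4. *)
Definition F32 : graph3 'I_5 :=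
  Graph3 (@list_edges_uniform3 5
    [:: [:: 0; 1; 2]; [:: 0; 1; 3]; [:: 0; 1; 4]; [:: 2; 3; 4]] isT).

(* Main.v *)
(** The induced count of 4.2 is bounded by a flag algebra certificate on seven
vertices.  Both forbidden graphs cover all pairs of their vertices, so the 3-graph
that a 7-tuple of vertices, repetitions allowed, induces on its seven indices is
again [K4minus]- and [F32]-free.  Summing over all 7-tuples is therefore exact, and it
suffices to exhibit four families of squares (rooted at a non-edge, at an edge, at a
pair with three common neighbours, and at a vertex) whose symmetrised sum, plus the
weighted number of quadruples with two edges, is at most a constant on every free
3-graph on seven points.  That pointwise inequality is checked by enumeration: every
such graph has a vertex of minimum degree, and after a permutation it is a
one-vertex extension, by such a vertex, of one of the 91 free 3-graphs on six
points.  This gives [216 e <= 5 n^4].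

The lower bound is the balanced blow-up of the 2-(6,3,2) design, in which 720 of
the [6^4] class patterns of a quadruple span two edges. *)

Require Import Defs.
From Stdlib Require Import ZArith.
From mathcomp Require Import boolp classical_sets.
From mathcomp Require Import all_boot all_order all_algebra.
From mathcomp Require Import zify ssrZ ring.
Set Implicit Arguments.
Unset Strict Implicit.
Unset Printing Implicit Defensive.
Import Order.TTheory GRing.Theory Num.Theory.

(** * Graphs on an initial segment of the integers *)

(** The extremal example dictates the squares. Equality holds asymptotically in the blow-up of the
    design, so every square has to vanish there; the forms are therefore written in combinations of
    flag sums that vanish on the blow-up. On this smaller space a matrix can be definite, which
    leaves room for rounding to integers and for a proof of positivity by diagonal dominance. The
    constants: a quadruple with two edges has coordinate 4, the number of automorphisms of 4.2,
    hence value 16, and 405 * 16 * 35 * 5/9 = 126000. So the pointwise bound speaks of density 5/9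
    among the 35 quadruples of seven points. The obstacle is the cost of the symmetrised sum. Each
    of its terms is invariant under a large stabiliser, so 35, 315, 105, 210 and 70 coset
    representatives replace the 5040 permutations, and each form is tabulated beforehand on pairs of
    flags. *)

Definition hyp := nat -> nat -> nat -> bool.

Definition pull (g : hyp) (p : seq nat) : hyp :=
  fun i j k => g (nth 0 p i) (nth 0 p j) (nth 0 p k).

Definition comp_idx (p q : seq nat) : seq nat := [seq nth 0 p i | i <- q].

(** Equality is asked only below [m]: beyond the length of its list, [pull] reads the default index
    0. *)
Definition agree (m : nat) (g h : hyp) : Prop :=
  forall i j k, i < m -> j < m -> k < m -> g i j k = h i j k.

Definition pairs (m : nat) : seq (nat * nat) :=
  flatten [seq [seq (i, j) | i <- iota 0 j] | j <- iota 0 m].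

(* Colexicographic order, so that [bits m g] is a prefix of [bits m.+1 g]. *)
Definition triples (m : nat) : seq (nat * nat * nat) :=
  flatten [seq [seq (p, k) | p <- pairs k] | k <- iota 0 m].

Definition bits (m : nat) (g : hyp) : seq bool :=
  [seq g t.1.1 t.1.2 t.2 | t <- triples m].

Lemma mem_pairs m i j : ((i, j) \in pairs m) = (i < j < m).
Proof.
apply/flatten_mapP/idP => [[j' + /mapP[i' + [-> ->]]]|/andP[ij jm]].
  by rewrite !mem_iota /= !add0n => -> ->.
by exists j; rewrite ?mem_iota//; apply: map_f; rewrite mem_iota.
Qed.

Lemma mem_triples m i j k : ((i, j, k) \in triples m) = [&& i < j, j < k & k < m].
Proof.
apply/flatten_mapP/idP => [[k' + /mapP[[i' j'] + [-> -> ->]]]|/and3P[ij jk km]].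
  by rewrite mem_iota mem_pairs /= add0n => -> /andP[-> ->].
exists k; rewrite ?mem_iota//.
by apply/mapP; exists (i, j); rewrite // mem_pairs ij.
Qed.

Lemma bits_agree m g h : agree m g h -> bits m g = bits m h.
Proof.
move=> gh; apply/eq_in_map => -[[i j] k] /=; rewrite mem_triples => /and3P[ij jk km].
have jm := ltn_trans jk km.
by apply: gh => //; exact: ltn_trans ij jm.
Qed.

Lemma bitsS m g :
  bits m.+1 g = bits m g ++ [seq g p.1 p.2 m | p <- pairs m].
Proof.
rewrite /bits /triples -addn1 iotaD map_cat flatten_cat map_cat; congr (_ ++ _).
by rewrite /= cats0 -map_comp.
Qed.

Lemma agree_sym m g h : agree m g h -> agree m h g.
Proof. by move=> gh i j k im jm km; rewrite gh. Qed.

Lemma agree_trans m g h f : agree m g h -> agree m h f -> agree m g f.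
Proof. by move=> gh hf i j k im jm km; rewrite gh ?hf. Qed.

Lemma agree_pull m n g h p :
  agree m g h -> all (gtn m) p -> size p = n -> agree n (pull g p) (pull h p).
Proof.
move=> gh /all_nthP pm <- i j k ip jp kp.
by apply: gh; apply: pm.
Qed.

Lemma pull_comp n g p q : size q = n ->
  agree n (pull g (comp_idx p q)) (pull (pull g p) q).
Proof. by move=> <- i j k ip jp kp; rewrite /pull !(nth_map 0). Qed.

Lemma pull_iota m n g : n <= m -> agree n (pull g (iota 0 m)) g.
Proof. by move=> nm i j k im jm km; rewrite /pull !nth_iota ?(leq_trans _ nm). Qed.

Definition is_perm (m : nat) (p : seq nat) := perm_eq p (iota 0 m).

Lemma is_perm_size m p : is_perm m p -> size p = m.
Proof. by move=> /perm_size; rewrite size_iota. Qed.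

Lemma is_perm_lt m p : is_perm m p -> all (gtn m) p.
Proof.
by move=> /perm_mem pm; apply/allP => i; rewrite pm mem_iota /= add0n.
Qed.

Lemma is_perm_comp m p q : is_perm m p -> is_perm m q -> is_perm m (comp_idx p q).
Proof.
move=> pp pq; apply: (@perm_trans _ p) => //.
by rewrite -[X in perm_eq _ X](mkseq_nth 0) (is_perm_size pp); exact: perm_map.
Qed.

Lemma is_perm_inj m p : is_perm m p -> {in gtn m &, injective (nth 0 p)}.
Proof.
move=> pp i j; rewrite !inE -(is_perm_size pp) => im jm /eqP.
by rewrite nth_uniq ?(perm_uniq pp) ?iota_uniq// => /eqP.
Qed.

Lemma comp_idx_inj m p q r : is_perm m p ->
  all (gtn m) q -> all (gtn m) r -> comp_idx p q = comp_idx p r -> q = r.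
Proof.
move=> pp /allP qm /allP rm e.
have sz : size q = size r by rewrite -(size_map (nth 0 p)) [map _ _]e size_map.
apply: (@eq_from_nth _ 0) => // i iq.
have ir : i < size r by rewrite -sz.
apply: (is_perm_inj pp).
- by apply: qm; rewrite mem_nth.
- by apply: rm; rewrite mem_nth.
- by rewrite -(nth_map 0 0)// -(nth_map 0 0 (nth 0 p) ir) -/(comp_idx p r) -e.
Qed.

Definition perms (m : nat) := permutations (iota 0 m).

Lemma mem_perms m p : (p \in perms m) = is_perm m p.
Proof. exact: mem_permutations. Qed.

Lemma perms_comp m p : is_perm m p ->
  perm_eq [seq comp_idx p q | q <- perms m] (perms m).
Proof.
move=> pp.
have U : uniq [seq comp_idx p q | q <- perms m].
  rewrite map_inj_in_uniq ?permutations_uniq// => q r; rewrite !mem_perms => qp rp.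
  by apply: (comp_idx_inj pp); apply: is_perm_lt.
have sub : {subset [seq comp_idx p q | q <- perms m] <= perms m}.
  by move=> q /mapP[r + ->]; rewrite !mem_perms; exact: is_perm_comp.
apply: uniq_perm => //; first exact: permutations_uniq.
by apply: (uniq_min_size U sub _).2; rewrite size_map leqnn.
Qed.

Lemma perm_eq_perms m L : all (is_perm m) L -> uniq L -> size L = m`! ->
  perm_eq L (perms m).
Proof.
move=> /allP Lm U sL.
have sub : {subset L <= perms m} by move=> p /Lm; rewrite mem_perms.
apply: uniq_perm => //; first exact: permutations_uniq.
apply: (uniq_min_size U sub _).2.
by rewrite sL size_permutations ?iota_uniq// size_iota leqnn.
Qed.

(** * Quadratic forms in flag sums *)

Section TupleSums.
Variables (V : finType) (x0 : V) (R : nmodType).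
Local Open Scope ring_scope.

Definition permute (p : seq nat) (t : seq V) : seq V := [seq nth x0 t i | i <- p].

Lemma sum_tuple_permute m p (F : seq V -> R) : is_perm m p ->
  \sum_(t : m.-tuple V) F (permute p t) = \sum_(t : m.-tuple V) F t.
Proof.
move=> pp.
have sz (t : m.-tuple V) : size (permute p t) == m.
  by rewrite size_map (is_perm_size pp).
pose h (t : m.-tuple V) := Tuple (sz t).
rewrite [RHS](reindex_inj (h := h)) //=.
move=> t u /(congr1 val) /= e; apply/val_inj/(@eq_from_nth _ x0).
  by rewrite !size_tuple.
move=> i; rewrite size_tuple => im.
have ip : i \in p by rewrite (perm_mem pp) mem_iota add0n.
have ip' : (index i p < size p)%N by rewrite index_mem.
have: nth x0 (permute p t) (index i p) = nth x0 (permute p u) (index i p) by rewrite e.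
by rewrite !(nth_map 0%N)// nth_index.
Qed.

Lemma sum_tuple_cat m n (F : seq V -> R) :
  \sum_(t : (m + n).-tuple V) F t =
  \sum_(u : m.-tuple V) \sum_(v : n.-tuple V) F (u ++ v).
Proof.
rewrite pair_big /=.
have szt (t : (m + n).-tuple V) : size (take m t) == m.
  by rewrite size_takel ?size_tuple ?leq_addr.
have szd (t : (m + n).-tuple V) : size (drop m t) == n.
  by rewrite size_drop size_tuple addKn.
rewrite (reindex (fun uv : m.-tuple V * n.-tuple V => cat_tuple uv.1 uv.2)) //=.
exists (fun t => (Tuple (szt t), Tuple (szd t))) => [[u v] _|t _].
  congr (_, _); apply: val_inj => /=.
    by rewrite take_size_cat ?size_tuple.
  by rewrite drop_size_cat ?size_tuple.
by apply: val_inj => /=; rewrite cat_take_drop.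
Qed.

End TupleSums.

(** The two adjacent transpositions generate all permutations of the arguments, so vanishing at
    [i i k] gives vanishing at every repeated argument. *)
Definition symmetric3 (g : hyp) : Prop :=
  [/\ forall i j k, g i j k = g j i k, forall i j k, g i j k = g i k j
    & forall i k, g i i k = false].

Lemma symmetric3_pull g p : symmetric3 g -> symmetric3 (pull g p).
Proof. by case=> s1 s2 s3; split=> *; [exact: s1|exact: s2|exact: s3]. Qed.

Section QuadraticForms.
Local Open Scope Z_scope.

Definition sumZ (s : seq Z) : Z := foldr Z.add 0 s.

Definition dot (u v : seq Z) : Z := sumZ [seq x.1 * x.2 | x <- zip u v].

Definition bform (M : seq (seq Z)) (u v : seq Z) : Z :=
  dot u [seq dot r v | r <- M].

Definition entry (M : seq (seq Z)) (i j : nat) : Z := nth 0 (nth [::] M i) j.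

Definition square (n : nat) (M : seq (seq Z)) : bool :=
  (size M == n) && all (fun r => size r == n) M.

Definition symmetricb (n : nat) (M : seq (seq Z)) : bool :=
  all (fun i => all (fun j => entry M i j == entry M j i) (iota 0 n)) (iota 0 n).

Definition residue (k : Z) (L M : seq (seq Z)) (i j : nat) : Z :=
  k * k * entry M i j - sumZ [seq nth 0 r i * nth 0 r j | r <- L].

(* [k ^ 2 M - L^T L] is diagonally dominant. *)
Definition psd_cert (n : nat) (k : Z) (L M : seq (seq Z)) : bool :=
  (0 <? k) && all (fun i =>
    sumZ [seq (if i == j then 0 else Z.abs (residue k L M i j)) | j <- iota 0 n]
      <=? residue k L M i i) (iota 0 n).

Lemma sumZE (s : seq Z) : sumZ s = (\sum_(x <- s) x)%R.
Proof. by elim: s => [|x s IH]; rewrite ?big_nil// big_cons /= IH. Qed.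

Local Open Scope ring_scope.

Lemma dotE n u v : size u = n -> size v = n ->
  dot u v = \sum_(i < n) nth 0 u i * nth 0 v i.
Proof.
move=> <-; elim: u v => [|x u IH] [|y v] //=; first by rewrite big_ord0.
by move=> [] /IH {}IH; rewrite big_ord_recl /= -IH.
Qed.

Lemma bformE n M u v : square n M -> size u = n -> size v = n ->
  bform M u v = \sum_(i < n) \sum_(j < n) entry M i j * (nth 0 u i * nth 0 v j).
Proof.
move=> /andP[/eqP sM /allP rM] su sv; rewrite /bform (@dotE n)// ?size_map//.
apply: eq_bigr => i _; rewrite (nth_map [::]) ?sM//.
have ri : nth [::] M i \in M by rewrite mem_nth ?sM.
rewrite (@dotE n)//; last exact/eqP/rM.
by rewrite mulr_sumr; apply: eq_bigr => j _; rewrite mulrCA.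
Qed.

Lemma entryC n M i j : symmetricb n M -> (i < n)%N -> (j < n)%N ->
  entry M i j = entry M j i.
Proof.
move=> /allP symM ni nj; have /symM /allP/(_ j) : i \in iota 0 n by rewrite mem_iota.
by rewrite mem_iota /= => /(_ nj) /eqP.
Qed.

Lemma bformC n M u v : square n M -> symmetricb n M -> size u = n -> size v = n ->
  bform M u v = bform M v u.
Proof.
move=> sqM symM su sv; rewrite !(@bformE n)// exchange_big /=.
apply: eq_bigr => i _; apply: eq_bigr => j _.
by rewrite (entryC symM)// [nth _ u _ * _]mulrC.
Qed.

(** An off-diagonal term is bounded by 2 F_ij x_i x_j >= -|F_ij| (x_i^2 + x_j^2), a square of a sum
    or of a difference according to the sign of F_ij; the diagonal pays for these losses. *)
Lemma diag_dominant_ge0 n (F : nat -> nat -> Z) (x : nat -> Z) :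
  (forall i j, (i < n)%N -> (j < n)%N -> F i j = F j i) ->
  (forall i, (i < n)%N -> \sum_(j < n) (if i == j then 0 else `|F i j|) <= F i i) ->
  0 <= \sum_(i < n) \sum_(j < n) F i j * (x i * x j).
Proof.
move=> symF domF; pose T i j := if i == j :> nat then 0 else `|F i j|.
rewrite -(@pmulrn_lge0 _ _ 2)// -sumrMnl.
(* This difference is in fact zero, by the symmetry of [T]; it is stated as an inequality to begin
   the chain of estimates. *)
have Z0 : 0 <= \sum_(i < n) (x i ^+ 2 * (\sum_(j < n) T i j)) *+ 2
    - \sum_(i < n) \sum_(j < n) T i j * (x i ^+ 2 + x j ^+ 2) :> Z.
  rewrite subr_ge0 le_eqVlt; apply/orP; left; apply/eqP/esym.
  under [RHS]eq_bigr do under eq_bigr do rewrite mulrDr.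
  under [RHS]eq_bigr do rewrite big_split /=.
  rewrite [RHS]big_split /= [X in _ = _ + X]exchange_big /= -[RHS]big_split /=.
  apply: eq_bigr => i _; rewrite mulr2n mulr_sumr; congr (_ + _).
    by apply: eq_bigr => j _; rewrite mulrC.
  by apply: eq_bigr => j _; rewrite mulrC /T eq_sym symF.
apply: le_trans Z0 _; rewrite -sumrB; apply: ler_sum => i _; rewrite lerBlDr.
apply: (@le_trans _ _ ((x i ^+ 2 * F i i) *+ 2)).
  by rewrite lerMn2r/= ler_wpM2l ?sqr_ge0//; exact: domF.
rewrite -sumrMnl -big_split /= (bigD1 i) //= /T eqxx mul0r addr0 -expr2 [F _ _ * _]mulrC.
rewrite lerDl; apply: sumr_ge0 => j ji.
rewrite ifN; last by rewrite eq_sym.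
case: (ger0P (F i j)) => F0.
  rewrite [X in 0 <= X](_ : _ = F i j * (x i + x j) ^+ 2); last by ring.
  by rewrite mulr_ge0 ?sqr_ge0.
rewrite [X in 0 <= X](_ : _ = - F i j * (x i - x j) ^+ 2); last by ring.
by rewrite mulr_ge0 ?sqr_ge0// oppr_ge0 ltW.
Qed.

(** k^2 M is the residue plus a sum of squares of the rows of [L]. With [L] close to k times a
    Cholesky factor, the residue is mostly rounding error, small enough for its diagonal to
    dominate. *)
Lemma psd_certP n k L M x : square n M -> symmetricb n M -> psd_cert n k L M ->
  size x = n -> 0 <= bform M x x.
Proof.
move=> sqM symM /andP[k0 /allP dom] sx; rewrite (@bformE n)//.
have k2 : 0 < k * k by rewrite mulr_gt0.
rewrite -(pmulr_rge0 _ k2).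
have -> : k * k * (\sum_(i < n) \sum_(j < n) entry M i j * (nth 0 x i * nth 0 x j)) =
    \sum_(i < n) \sum_(j < n) residue k L M i j * (nth 0 x i * nth 0 x j)
    + \sum_(r <- L) (\sum_(i < n) nth 0 r i * nth 0 x i) ^+ 2.
  transitivity (\sum_(i < n) \sum_(j < n) (residue k L M i j * (nth 0 x i * nth 0 x j)
    + \sum_(r <- L) (nth 0 r i * nth 0 x i) * (nth 0 r j * nth 0 x j))).
    rewrite mulr_sumr; apply: eq_bigr => i _; rewrite mulr_sumr; apply: eq_bigr => j _.
    rewrite /residue sumZE big_map; set S := (\sum_(r <- L) _ in X in X + _).
    have -> : \sum_(r <- L) (nth 0 r i * nth 0 x i) * (nth 0 r j * nth 0 x j)
        = S * (nth 0 x i * nth 0 x j).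
      by rewrite mulr_suml; apply: eq_bigr => r _; ring.
    by rewrite /GRing.add /GRing.mul /=; lia.
  under eq_bigr do rewrite big_split /=.
  rewrite big_split /=; congr (_ + _).
  under eq_bigr do rewrite exchange_big /=.
  rewrite exchange_big /=; apply: eq_bigr => r _.
  by rewrite expr2 mulr_suml; apply: eq_bigr => i _; rewrite mulr_sumr.
apply: addr_ge0; last by apply: sumr_ge0 => r _; exact: sqr_ge0.
apply: (diag_dominant_ge0 (F := residue k L M) (fun i => nth 0 x i)) => [i j ni nj|i ni].
  rewrite /residue (entryC symM)//; congr (_ - sumZ _)%Z.
  by apply/eq_map => r; rewrite Z.mul_comm.
have /dom : i \in iota 0 n by rewrite mem_iota.
by rewrite sumZE big_map -(big_mkord xpredT (fun j => if i == j then 0 else `|residue k L M i j|))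
  /index_iota subn0.
Qed.

End QuadraticForms.

(* The coordinate attached to a code in [bC] is the indicator of that code,
   (anti)symmetrised over the signed group [bG] acting on the [bs] roots and the
   [be] further vertices of a flag; [bM] is the matrix of a quadratic form in the
   linear combinations [bO] of these coordinates. *)
Record block := Block {
  bs : nat; be : nat;
  bG : seq (seq nat * bool);
  bC : seq (seq bool);
  bO : seq (seq Z);
  bM : seq (seq Z)
}.

Section Block.
Local Open Scope Z_scope.
Variable B : block.
Let m := (bs B + be B)%N.

Definition sgn (b : bool) : Z := if b then -1 else 1.

Definition coord (h : hyp) (c : seq bool) : Z :=
  sumZ [seq if bits m (pull h q.1) == c then sgn q.2 else 0 | q <- bG B].

Definition coords (h : hyp) : seq Z := [seq coord h c | c <- bC B].

Definition lins (h : hyp) : seq Z := [seq dot o (coords h) | o <- bO B].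

(** The two flags share the roots and are otherwise disjoint, so their union occupies
    [bs B + (be B + be B)] indices. *)
Definition ext1 := iota 0 m.
Definition ext2 := (iota 0 (bs B) ++ iota m (be B))%SEQ.

Definition psi (g : hyp) : Z := bform (bM B) (lins (pull g ext1)) (lins (pull g ext2)).

Definition block_ok : bool :=
  [&& all (fun q => is_perm m q.1) (bG B), square (size (bO B)) (bM B)
    & symmetricb (size (bO B)) (bM B)].

Lemma coord_agree h h' c : all (fun q => is_perm m q.1) (bG B) ->
  agree m h h' -> coord h c = coord h' c.
Proof.
move=> /allP ok hh; congr sumZ; apply/eq_in_map => q /ok qp.
rewrite (@bits_agree m (pull h q.1) (pull h' q.1))//.
by apply: agree_pull hh (is_perm_lt qp) (is_perm_size qp).
Qed.

Lemma lins_agree h h' : all (fun q => is_perm m q.1) (bG B) ->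
  agree m h h' -> lins h = lins h'.
Proof.
move=> ok hh; apply/eq_map => q; congr dot.
by apply/eq_map => c; exact: coord_agree.
Qed.

Hypothesis ok : block_ok.

Let okG : all (fun q => is_perm m q.1) (bG B).
Proof. by case/and3P: ok. Qed.

Let sqM : square (size (bO B)) (bM B).
Proof. by case/and3P: ok. Qed.

Lemma size_lins h : size (lins h) = size (bO B).
Proof. by rewrite size_map. Qed.

Section Positivity.
Variables (V : finType) (x0 : V) (E : V -> V -> V -> bool).

Definition idx (t : seq V) : hyp :=
  fun i j k => E (nth x0 t i) (nth x0 t j) (nth x0 t k).

Lemma idx_permute p t n : size p = n -> agree n (idx (permute x0 p t)) (pull (idx t) p).
Proof. by move=> <- i j k ip jp kp; rewrite /idx /pull !(nth_map 0%N). Qed.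

(** For fixed roots [r] the two extensions [u] and [v] range independently, repetitions included.
    The double sum thus factors exactly as the form at the vector [X] of flag sums over all
    extensions, with no error term. *)
Lemma sum_psi_ge0 :
  (forall x, size x = size (bO B) -> (0 <= bform (bM B) x x)%R) ->
  (0 <= \sum_(t : (bs B + (be B + be B)).-tuple V) psi (idx t))%R.
Proof.
move=> psd; rewrite (sum_tuple_cat _ _ (fun t => psi (idx t))).
apply: sumr_ge0 => r _.
rewrite (sum_tuple_cat _ _ (fun t => psi (idx (r ++ t)))).
have E1 (u v : (be B).-tuple V) :
    lins (pull (idx (r ++ (u ++ v))) ext1) = lins (idx (r ++ u)).
  apply: lins_agree => //; apply: agree_trans (pull_iota _ (leqnn _)) _.
  move=> i j k im jm km; rewrite /idx catA.
  by rewrite !(nth_cat x0 (r ++ u)) !size_cat !size_tuple im jm km.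
have E2 (u v : (be B).-tuple V) :
    lins (pull (idx (r ++ (u ++ v))) ext2) = lins (idx (r ++ v)).
  have F i : (i < m)%N ->
      nth x0 (r ++ (u ++ v)) (nth 0%N ext2 i) = nth x0 (r ++ v) i.
    move=> im; rewrite /ext2 (nth_cat 0%N) size_iota.
    case: ltnP => [ir|ri].
      by rewrite nth_iota// add0n !nth_cat size_tuple ir.
    have ie : (i - bs B < be B)%N by rewrite ltn_subLR.
    rewrite nth_iota// catA nth_cat size_cat !size_tuple ltnNge leq_addr addKn /=.
    by rewrite nth_cat size_tuple ltnNge ri.
  by apply: lins_agree => // i j k im jm km; rewrite /idx /pull !F.
set n := size (bO B).
pose X := mkseq (fun i => \sum_(u : (be B).-tuple V) nth 0 (lins (idx (r ++ u))) i)%R n.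
suff -> : (\sum_(u : (be B).-tuple V) \sum_(v : (be B).-tuple V)
    psi (idx (r ++ (u ++ v))))%R = bform (bM B) X X.
  by apply: psd; rewrite size_mkseq.
rewrite (@bformE n) ?size_mkseq//.
under eq_bigr do under eq_bigr do
  rewrite /psi E1 E2 (@bformE n) ?size_lins//.
under eq_bigr do rewrite exchange_big /=.
rewrite exchange_big /=; apply: eq_bigr => i _.
under eq_bigr do rewrite exchange_big /=.
rewrite exchange_big /=; apply: eq_bigr => j _.
rewrite !nth_mkseq// mulr_suml mulr_sumr; apply: eq_bigr => u _.
by rewrite mulr_sumr mulr_sumr.
Qed.

End Positivity.

(** Left translation by an element permutes the signed list and multiplies the signs, so each
    coordinate is an eigenvector of the group, with the sign as eigenvalue. *)
Definition group_ok : bool :=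
  all (fun q => perm_eq [seq (comp_idx q.1 r.1, q.2 (+) r.2) | r <- bG B] (bG B)) (bG B).

Lemma coord_pull h q c : group_ok -> q \in bG B ->
  coord (pull h q.1) c = sgn q.2 * coord h c.
Proof.
move=> /allP gok qG; rewrite /coord !sumZE !big_map.
rewrite -[in RHS](perm_big _ (gok q qG)) /= big_map -[RHS]/(GRing.mul (sgn q.2) _).
rewrite mulr_sumr !big_seq.
apply: eq_bigr => r rG /=.
have rp : is_perm m r.1 := allP okG r rG.
rewrite -(bits_agree (pull_comp h q.1 (is_perm_size rp))).
by case: ifP; rewrite ?mulr0//; case: q.2; case: r.2.
Qed.

Lemma dot_sgn b u v : dot u [seq sgn b * x | x <- v] = sgn b * dot u v.
Proof.
elim: u v => [|x u IH] [|y v]; rewrite /dot /= ?Z.mul_0_r//.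
by rewrite -!/(dot _ _) IH; ring.
Qed.

Lemma lins_pull h q : group_ok -> q \in bG B ->
  lins (pull h q.1) = [seq sgn q.2 * x | x <- lins h].
Proof.
move=> gok qG; rewrite /lins -map_comp; apply/eq_map => r /=.
rewrite -dot_sgn /coords -map_comp; congr dot.
by apply/eq_map => c /=; exact: coord_pull.
Qed.

Lemma bform_sgn b u v : size u = size (bO B) -> size v = size (bO B) ->
  bform (bM B) [seq sgn b * x | x <- u] [seq sgn b * x | x <- v] = bform (bM B) u v.
Proof.
move=> su sv; rewrite !(@bformE (size (bO B))) ?size_map//.
apply: eq_bigr => i _; apply: eq_bigr => j _.
rewrite !(nth_map 0) ?su ?sv//; congr (_ * _)%R.
rewrite -[LHS]/((sgn b * nth 0%R u i) * (sgn b * nth 0%R v j))%R mulrACA -[RHS]mul1r.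
by congr (_ * _)%R; case: (b).
Qed.

(** [p] preserves the pair of flags, possibly exchanging them, up to group elements of equal sign.
    The two signs cancel in the bilinear form, and the exchange is absorbed by the symmetry of the
    matrix. *)
Definition stab_ok (p : seq nat) : bool :=
  has (fun q1 => has (fun q2 => (q1.2 == q2.2) &&
    ((comp_idx p ext1 == comp_idx ext1 q1.1) && (comp_idx p ext2 == comp_idx ext2 q2.1)
  || (comp_idx p ext1 == comp_idx ext2 q1.1) && (comp_idx p ext2 == comp_idx ext1 q2.1)))
    (bG B)) (bG B).

Lemma size_ext1 : size ext1 = m.
Proof. by rewrite size_iota. Qed.

Lemma size_ext2 : size ext2 = m.
Proof. by rewrite size_cat !size_iota. Qed.

Lemma psi_stab g p : group_ok -> stab_ok p -> psi (pull g p) = psi g.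
Proof.
move=> gok /hasP[q1 q1G /hasP[q2 q2G /andP[/eqP q12]]].
have aux e e' q : size e = m -> q \in bG B -> comp_idx p e = comp_idx e' q.1 ->
    lins (pull (pull g p) e) = [seq sgn q.2 * x | x <- lins (pull g e')].
  move=> se qG ee; rewrite -lins_pull//; apply: lins_agree => //.
  apply: agree_trans (agree_sym (pull_comp g p se)) _; rewrite ee.
  by apply: pull_comp; apply: is_perm_size; exact: (allP okG).
rewrite /psi => /orP[] /andP[/eqP e1 /eqP e2].
  by rewrite (aux _ _ _ size_ext1 q1G e1) (aux _ _ _ size_ext2 q2G e2) q12 bform_sgn ?size_lins//.
rewrite (aux _ _ _ size_ext1 q1G e1) (aux _ _ _ size_ext2 q2G e2) q12 bform_sgn ?size_lins//.
by apply: bformC; rewrite ?size_lins//; case/and3P: ok.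
Qed.

Lemma psi_agree g h : agree (bs B + (be B + be B)) g h -> psi g = psi h.
Proof.
move=> gh; rewrite /psi (@lins_agree (pull g ext1) (pull h ext1)) //.
  congr bform; apply: lins_agree => //; apply: agree_pull gh _ size_ext2.
  by rewrite all_cat; apply/andP; split; apply/allP => i; rewrite mem_iota /=; lia.
apply: agree_pull gh _ size_ext1.
by apply/allP => i; rewrite mem_iota /=; lia.
Qed.

Hypothesis m7 : (bs B + (be B + be B) <= 7)%N.

Lemma psi_agree7 g h : agree 7 g h -> psi g = psi h.
Proof.
move=> gh; apply: psi_agree => i j k im jm km.
by apply: gh; apply: leq_trans m7.
Qed.

Definition orbit_sum (P : seq (seq nat)) (g : hyp) : Z := sumZ [seq psi (pull g p) | p <- P].

(* [P] is a transversal of the cosets of the stabiliser [St] in the group of all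
   permutations of the seven indices. *)
Definition transversal (P St : seq (seq nat)) : bool :=
  [&& all stab_ok St, all (is_perm 7) P, all (is_perm 7) St, St != [::] &
      perm_eq [seq comp_idx p q | p <- P, q <- St] (perms 7)].

Lemma orbit_sum_full P St g : group_ok -> transversal P St ->
  (\sum_(p <- perms 7) psi (pull g p))%R = (orbit_sum P g *+ size St)%R.
Proof.
move=> gok /and5P[/allP sok _ /allP s7 _ PS].
rewrite -(perm_big _ PS) /= big_flatten big_map /orbit_sum sumZE big_map -sumrMnl.
apply: eq_bigr => p _; rewrite big_map -[in RHS]sum1_size -sumrMnr !big_seq.
apply: eq_bigr => q qS.
rewrite -(psi_stab (pull g p) gok (sok q qS)).
by apply: psi_agree7; apply: pull_comp; apply: is_perm_size; exact: s7.
Qed.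

(** Multiplied by the order of the stabiliser, both sides become sums over all permutations, which a
    translation only reorders. The factor is then cancelled. *)
Lemma orbit_sum_pull P St g p : group_ok -> transversal P St -> is_perm 7 p ->
  orbit_sum P (pull g p) = orbit_sum P g.
Proof.
move=> gok PS pp; have /and5P[_ _ _ S0 _] := PS.
have S0' : (0 < size St)%N by rewrite lt0n size_eq0.
apply: (pmulrnI S0').
rewrite -!orbit_sum_full// -[in RHS](perm_big _ (perms_comp pp)).
rewrite big_map !big_seq; apply: eq_bigr => q; rewrite mem_perms => qp.
by apply: psi_agree7; apply/agree_sym/pull_comp/is_perm_size.
Qed.

Lemma sum_orbit_sum (V : finType) (x0 : V) (E : V -> V -> V -> bool) P :
  all (is_perm 7) P ->
  (\sum_(t : 7.-tuple V) orbit_sum P (idx x0 E t))%R =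
  ((\sum_(t : 7.-tuple V) psi (idx x0 E t)) *+ size P)%R.
Proof.
move=> /allP P7; under eq_bigr do rewrite /orbit_sum sumZE big_map.
rewrite exchange_big /= (eq_big_seq (fun=> \sum_(t : 7.-tuple V) psi (idx x0 E t))%R).
  by rewrite big_const_seq count_predT iter_addr_0.
move=> p /P7 pp.
rewrite -[RHS](sum_tuple_permute x0 (fun t => psi (idx x0 E t)) pp).
by apply: eq_bigr => t _; apply/psi_agree7/agree_sym/idx_permute/is_perm_size.
Qed.

End Block.

(** * Tabulated evaluation *)

Definition sort3 (i j k : nat) : nat * nat * nat :=
  let lo := minn i (minn j k) in let hi := maxn i (maxn j k) in
  (lo, i + j + k - lo - hi, hi).

(** A triple with a repeated entry is not listed in [triples m]; its index is then past the end and
    the default [false] is read. *)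
Definition look (m : nat) (c : seq bool) (i j k : nat) : bool :=
  nth false c (index (sort3 i j k) (triples m)).

Definition dec (m : nat) (c : seq bool) : hyp :=
  let I := iota 0 m in
  let tb := [seq [seq [seq look m c i j k | k <- I] | j <- I] | i <- I] in
  fun i j k => nth false (nth [::] (nth [::] tb i) j) k.

Lemma decE m c i j k : i < m -> j < m -> k < m -> dec m c i j k = look m c i j k.
Proof.
move=> im jm km; rewrite /dec.
by do ! (rewrite (nth_map 0) ?size_iota// nth_iota//).
Qed.

Lemma sort3E g i j k a b c : symmetric3 g -> sort3 i j k = (a, b, c) ->
  g i j k = if (a < b) && (b < c) then g a b c else false.
Proof.
move=> [s12 s23 irr] [<- <- <-].
have irr' u v : g u v v = false by rewrite s12 s23 irr.
have irr'' u v : g u v u = false by rewrite s23 irr.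
have [ij|ij|ij] := ltngtP i j; have [jk|jk|jk] := ltngtP j k;
  have [ik|ik|ik] := ltngtP i k; subst; rewrite ?irr ?irr' ?irr''; try lia;
  try (rewrite (_ : _ && _ = false) //; lia);
  rewrite (_ : _ && _ = true); try lia.
- by congr g; lia.
- by rewrite s23; congr g; lia.
- by rewrite s23 s12; congr g; lia.
- by rewrite s12; congr g; lia.
- by rewrite s12 s23; congr g; lia.
- by rewrite s12 s23 s12; congr g; lia.
Qed.

Lemma dec_bits m g : symmetric3 g -> agree m (dec m (bits m g)) g.
Proof.
move=> sg i j k im jm km; rewrite decE// /look.
case E : sort3 => [[a b] c]; rewrite (sort3E sg E).
have cm : c < m by move: E => [_ _ <-]; lia.
case: (boolP ((a, b, c) \in triples m)) => [abc|nabc].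
  have /and3P[ab bc _] : [&& a < b, b < c & c < m] by rewrite -mem_triples.
  by rewrite ab bc /= (nth_map (0, 0, 0)) ?index_mem// nth_index.
rewrite nth_default; last by rewrite size_map leqNgt index_mem.
by move: nabc; rewrite mem_triples cm andbT => /negbTE ->.
Qed.

(** * Tries indexed by bit strings *)

Inductive trie (A : Type) := Leaf of A | Node of trie A & trie A.

Fixpoint walk (A : Type) (d : A) (t : trie A) (b : seq bool) : A :=
  match t with
  | Leaf a => a
  | Node t1 t0 => match b with
    | [::] => d
    | x :: b' => if x then walk d t1 b' else walk d t0 b'
    end
  end.

Definition branch (A : Type) (x : bool) (l : seq (seq bool * A)) : seq (seq bool * A) :=
  [seq (behead q.1, q.2) | q <- l & head false q.1 == x].

Fixpoint build (A : Type) (d : A) (n : nat) (l : seq (seq bool * A)) : trie A :=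
  if l is q :: _ then
    if n is n'.+1 then Node (build d n' (branch true l)) (build d n' (branch false l))
    else Leaf q.2
  else Leaf d.

Fixpoint get (A : Type) (d : A) (l : seq (seq bool * A)) (b : seq bool) : A :=
  if l is q :: l' then if q.1 == b then q.2 else get d l' b else d.

Lemma get_branch (A : Type) (d : A) x (l : seq (seq bool * A)) b n :
  all (fun q => size q.1 == n.+1) l -> get d (branch x l) b = get d l (x :: b).
Proof.
elim: l => //= -[[|y k] a] l IH //= /andP[_ /IH {}IH].
rewrite /branch /= -/(branch x l); case: eqVneq => [->|yx] /=; rewrite ?IH eqseq_cons ?eqxx//.
by rewrite (negbTE yx).
Qed.

Lemma walk_build (A : Type) (d : A) n (l : seq (seq bool * A)) b :
  all (fun q => size q.1 == n) l -> size b = n -> walk d (build d n l) b = get d l b.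
Proof.
elim: n l b => [|n IH] l b ok.
  by case: b => // _; case: l ok => //= -[[|//] a] l _ /=.
case: b => // x b [bn]; case: l ok => // q l ok.
have okb y : all (fun q => size q.1 == n) (branch y (q :: l)).
  rewrite all_map; elim: (q :: l) ok => //= -[[|z k] a] l' IHl //= /andP[sk /IHl ok'].
  by case: ifP => //= _; rewrite -eqSS sk.
have -> : walk d (build d n.+1 (q :: l)) (x :: b) = walk d (build d n (branch x (q :: l))) b.
  by case: x.
by rewrite IH// (get_branch d x b ok).
Qed.

Lemma get_map (A : Type) (d : A) (f : seq bool -> A) (l : seq (seq bool)) b :
  get d [seq (c, f c) | c <- l] b = if b \in l then f b else d.
Proof.
by elim: l => //= c l ->; rewrite inE eq_sym; case: eqVneq => //= ->.
Qed.

Lemma map_const (T U : Type) (x : U) (s : seq T) : [seq x | _ <- s] = nseq (size s) x.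
Proof. by elim: s => //= _ s ->. Qed.

Section Table.
Variable B : block.
Let m := bs B + be B.

(** The images of the listed codes under the group: outside them all coordinates vanish, so the
    table need not contain anything else. *)
Definition live : seq (seq bool) :=
  undup [seq bits m (pull (dec m c) q.1) | c <- bC B, q <- bG B].

Definition feat (c : seq bool) : seq Z := lins B (dec m c).

(** [W] holds the product of the matrix with each feature vector, so that an entry costs one further
    dot product. *)
Definition table : trie (trie Z) :=
  let n := size (triples m) in
  let F := [seq (c, feat c) | c <- live] in
  let W := [seq (q.1, [seq dot r q.2 | r <- bM B]) | q <- F] in
  build (Leaf Z0) n
    [seq (q.1, build Z0 n [seq (w.1, dot q.2 w.2) | w <- W]) | q <- F].

Definition look2 (T : trie (trie Z)) (x y : seq bool) : Z :=
  walk Z0 (walk (Leaf Z0) T x) y.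

Definition inverse_ok : bool :=
  all (fun q => has (fun r => comp_idx q.1 r.1 == iota 0 m) (bG B)) (bG B).

Hypothesis ok : block_ok B.
Hypothesis iok : inverse_ok.

Let okG q : q \in bG B -> is_perm m q.1.
Proof. by move=> qG; case/and3P: ok => /allP /(_ _ qG). Qed.

(** A nonzero summand means that [h] pulled back along some group element has code [c]; the inverse
    element, supplied by [inverse_ok], then exhibits the code of [h] as an image of [c]. *)
Lemma coord_live h c : symmetric3 h -> c \in bC B -> bits m h \notin live ->
  coord B h c = Z0.
Proof.
move=> sh cC hl; rewrite /coord sumZE big_map big_seq big1// => q qG.
case: ifP => // /eqP e; case/negP: hl.
have /hasP[r rG /eqP qr] := allP iok q qG.
have -> : bits m h = bits m (pull (dec m c) r.1).
  apply/esym/bits_agree.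
  apply: agree_trans (agree_pull _ (is_perm_lt (okG rG)) (is_perm_size (okG rG))) _.
    by rewrite -e; apply/dec_bits/symmetric3_pull.
  apply: agree_trans (agree_sym (pull_comp _ _ (is_perm_size (okG rG)))) _.
  by rewrite qr; exact: pull_iota.
by rewrite mem_undup; apply: allpairs_f.
Qed.

Lemma dot0 u n : dot u (nseq n Z0) = Z0.
Proof. by elim: u n => [|x u IH] [|n] //=; rewrite /dot /= Z.mul_0_r -/(dot _ _) IH. Qed.

Lemma dot0l u n : dot (nseq n Z0) u = Z0.
Proof. by elim: u n => [|x u IH] [|n] //=; rewrite /dot /= -/(dot _ _) IH. Qed.

Lemma lins_live h : symmetric3 h -> bits m h \notin live ->
  lins B h = nseq (size (bO B)) Z0.
Proof.
move=> sh hl; rewrite /lins.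
have -> : coords B h = nseq (size (bC B)) Z0.
  rewrite -(map_const _ (bC B)); apply/eq_in_map => c cC; exact: coord_live.
by rewrite -(map_const _ (bO B)); apply/eq_map => o; rewrite dot0.
Qed.

Lemma lins_bits h : symmetric3 h -> lins B h = feat (bits m h).
Proof.
move=> sh; apply: lins_agree; first by case/and3P: ok.
exact/agree_sym/dec_bits.
Qed.

Lemma size_bits n g : size (bits n g) = size (triples n).
Proof. by rewrite size_map. Qed.

Lemma size_live : all (fun c => size c == size (triples m)) live.
Proof.
apply/allP => c; rewrite mem_undup => /allpairsP[[d q] /= [_ _ ->]].
by rewrite size_bits.
Qed.

Lemma look2_table h h' : symmetric3 h -> symmetric3 h' ->
  look2 table (bits m h) (bits m h') = bform (bM B) (lins B h) (lins B h').
Proof.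
move=> sh sh'; rewrite /look2 /table.
set n := size _.
set W := [seq (q.1, [seq dot r q.2 | r <- bM B]) | q <- _].
have EW v : [seq (w.1, dot v w.2) | w <- W] =
    [seq (c, bform (bM B) v (feat c)) | c <- live].
  by rewrite /W -!map_comp; apply/eq_map.
rewrite -map_comp walk_build ?size_bits//; last first.
  by rewrite all_map; apply: sub_all size_live => c.
rewrite (@get_map _ _ (fun c => build Z0 n [seq (w.1, dot (feat c) w.2) | w <- W])).
case: (boolP (bits m h \in live)) => [_|hl]; last first.
  by rewrite (lins_live sh hl) /bform dot0l.
rewrite EW walk_build ?size_bits//; last first.
  by rewrite all_map; apply: sub_all size_live => c.
rewrite get_map -lins_bits//; case: ifP => [_|/negbT hl]; first by rewrite -lins_bits.
rewrite (lins_live sh' hl) /bform -[LHS](dot0 (lins B h) (size (bM B))); congr dot.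
by rewrite -(map_const _ (bM B)); apply/eq_map => r; rewrite dot0.
Qed.

Definition vsum (T : trie (trie Z)) (P : seq (seq nat)) (g : hyp) : Z :=
  sumZ [seq look2 T (bits m (pull g (comp_idx p (ext1 B))))
                    (bits m (pull g (comp_idx p (ext2 B)))) | p <- P].

Hypothesis m7 : bs B + (be B + be B) <= 7.

Lemma vsumE P g : symmetric3 g -> all (is_perm 7) P ->
  vsum table P (dec 7 (bits 7 g)) = orbit_sum B P g.
Proof.
move=> sg /allP P7; congr sumZ; apply/eq_in_map => p /P7 pp.
have le7 : m + be B <= 7 by rewrite -addnA.
have aux e : size e = m -> all (gtn 7) e ->
    bits m (pull (dec 7 (bits 7 g)) (comp_idx p e)) = bits m (pull (pull g p) e).
  move=> se e7; apply: bits_agree; apply: agree_trans _ (pull_comp g p se).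
  have sz : size (comp_idx p e) = m by rewrite size_map.
  apply: agree_pull (@dec_bits 7 g sg) _ sz.
  apply/allP => _ /mapP[i ie ->]; apply: (allP (is_perm_lt pp)).
  by rewrite mem_nth// (is_perm_size pp); exact: (allP e7).
rewrite !aux ?size_ext1 ?size_ext2// ?look2_table//; first last.
- by apply/allP => i; rewrite mem_iota /=; lia.
- by rewrite all_cat; apply/andP; split; apply/allP => i; rewrite mem_iota /=; lia.
all: by do ! apply: symmetric3_pull.
Qed.
End Table.

(** * Enumeration of the free graphs *)

(** The vertices are not assumed distinct: the edges listed cover every pair, and an edge has
    distinct arguments. Goodness therefore passes to [pull] along lists with repetitions. *)
Definition good (g : hyp) : Prop :=
  [/\ symmetric3 g,
      forall a b c d, ~~ [&& g a b c, g a b d & g a c d]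
    & forall a b c d e, ~~ [&& g a b c, g a b d, g a b e & g c d e]].

Lemma good_pull g p : good g -> good (pull g p).
Proof.
by move=> [sg k4 f32]; split=> *; [exact: symmetric3_pull|exact: k4|exact: f32].
Qed.

(** Ordered pairs are counted, which for symmetric [g] gives twice the usual degree. *)
Definition degree (m : nat) (g : hyp) (i : nat) : nat :=
  sumn [seq sumn [seq nat_of_bool (g i j k) | k <- iota 0 m] | j <- iota 0 m].

Lemma degreeE m g i :
  degree m g i = \sum_(j <- iota 0 m) \sum_(k <- iota 0 m) g i j k.
Proof.
by rewrite /degree sumnE big_map; apply: eq_bigr => j _; rewrite sumnE big_map.
Qed.

Lemma degree_pull m g p i : is_perm m p ->
  degree m (pull g p) i = degree m g (nth 0 p i).
Proof.
move=> pp; have E (F : nat -> nat) :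
    \sum_(j <- iota 0 m) F (nth 0 p j) = \sum_(j <- iota 0 m) F j.
  have sp : [seq nth 0 p j | j <- iota 0 m] = p.
    by rewrite -(is_perm_size pp); exact: mkseq_nth.
  by rewrite -[RHS](perm_big _ pp) /= -[in RHS]sp big_map.
rewrite !degreeE -[RHS]E; apply: eq_bigr => j _.
exact: (E (fun k => g (nth 0 p i) (nth 0 p j) k : nat)).
Qed.

Section Extensions.
Variable m : nat.

Definition pos (i j : nat) : nat := index (minn i j, maxn i j) (pairs m).

Definition link_bits (g : hyp) : seq bool := [seq g q.1 q.2 m | q <- pairs m].

Definition star (i : nat) : seq nat := [seq pos i k | k <- iota 0 m & k != i].

(** The copies of K_4^- on [q], a third old vertex [k] and the new vertex [m], given that [q] enters
    the link of [m]. If [q] and [k] form an edge, neither other pair may be in the link; otherwise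
    not both may be. *)
Definition checks (g : hyp) (q : nat * nat) : seq (bool * nat * nat) :=
  [seq (g q.1 q.2 k, pos q.1 k, pos q.2 k) | k <- iota 0 m & (k != q.1) && (k != q.2)].

Definition check (l : seq bool) (t : bool * nat * nat) : bool :=
  let x := nth false l t.1.2 in let y := nth false l t.2 in
  if t.1.1 then ~~ x && ~~ y else ~~ (x && y).

(** Breadth-first construction of the link of the new vertex, one pair at a time. Undecided pairs
    read as [false], so a conflict is detected when its last pair is decided. *)
Fixpoint links (cs : seq (seq (bool * nat * nat))) (acc : seq (seq bool)) :=
  if cs is c :: cs' then
    links cs' (flatten [seq rcons l false ::
      (if all (check l) c then [:: rcons l true] else [::]) | l <- acc])
  else acc.

(** [I] lists the degrees in the link. Their sum is the degree of the new vertex, counted in ordered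
    pairs, and an old vertex gains twice its entry. *)
Definition min_last (D : seq nat) (S : seq (seq nat)) (l : seq bool) : bool :=
  let I := [seq count (nth false l) s | s <- S] in
  let s := sumn I in
  all (fun d => s <= d.1 + (d.2 + d.2)) (zip D I).

(** Copies of F_{3,2} in which the new vertex is 1 or 2: with partner [b], it may not see all three
    vertices of an edge. *)
Definition triple_tests (g : hyp) : seq (seq nat) :=
  flatten [seq [seq [:: pos b t.1.1; pos b t.1.2; pos b t.2]
     | b <- iota 0 m & (b != t.1.1) && (b != t.1.2) && (b != t.2)]
     | t <- triples m & g t.1.1 t.1.2 t.2].

(** Copies of F_{3,2} in which the new vertex is 3, 4 or 5: [q] is the pair 12, and [r] consists of
    two common neighbours of it. *)
Definition pair_tests (g : hyp) : seq (seq nat) :=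
  flatten [seq [seq [:: pos q.1 q.2; pos r.1 r.2]
     | r <- pairs m & g q.1 q.2 r.1 && g q.1 q.2 r.2] | q <- pairs m].

Definition exts (c : seq bool) : seq (seq bool) :=
  let g := dec m c in
  let D := [seq degree m g i | i <- iota 0 m] in
  let S := [seq star i | i <- iota 0 m] in
  let tests := triple_tests g ++ pair_tests g in
  [seq c ++ l | l <- links [seq checks g q | q <- pairs m] [:: [::]]
    & min_last D S l && all (fun s => ~~ all (nth false l) s) tests].

Lemma nth_link g i k : symmetric3 g -> i < m -> k < m -> i != k ->
  nth false (link_bits g) (pos i k) = g i k m.
Proof.
move=> [s12 _ _] im km ik.
have ip : (minn i k, maxn i k) \in pairs m by rewrite mem_pairs; lia.
rewrite (nth_map (0, 0)) ?index_mem// nth_index//=.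
by have [_|_|eik] := ltngtP i k => //; rewrite eik eqxx in ik.
Qed.

Lemma nth_link_take g t i k : symmetric3 g -> i < m -> k < m -> i != k ->
  nth false (take t (link_bits g)) (pos i k) -> g i k m.
Proof.
move=> sg im km ik; rewrite -nth_link//.
have [it|ti] := ltnP (pos i k) t; first by rewrite nth_take.
by rewrite nth_default// size_take_min; lia.
Qed.

Lemma linksP g h : good g -> agree m h g ->
  link_bits g \in links [seq checks h q | q <- pairs m] [:: [::]].
Proof.
move=> [sg k4 f32] hg; have [s12 s23 irr] := sg.
(* Invariant: once the pairs [ps] are decided, the truncation of the true link is still among the
   candidates. *)
suff H ps qs acc : pairs m = ps ++ qs -> take (size ps) (link_bits g) \in acc ->
    link_bits g \in links [seq checks h q | q <- qs] acc.
  by apply: (H [::]); rewrite ?take0 ?inE.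
elim: qs ps acc => [|q qs IH] ps acc e ina.
  by move: ina; rewrite take_oversize// size_map e cats0.
have qm : q \in pairs m by rewrite e mem_cat inE eqxx orbT.
move: (qm); case: (q) e => q1 q2 e; rewrite mem_pairs => /andP[q12 q2m] {qm}.
have q1m : q1 < m by exact: ltn_trans q2m.
apply: (IH (rcons ps (q1, q2))); first by rewrite cat_rcons.
have szp : size ps < size (pairs m) by rewrite e size_cat /=; lia.
have -> : take (size (rcons ps (q1, q2))) (link_bits g) =
    rcons (take (size ps) (link_bits g)) (g q1 q2 m).
  rewrite size_rcons (take_nth false) ?size_map//; congr rcons.
  by rewrite (nth_map (0, 0))// e nth_cat ltnn subnn.
apply/flatten_mapP; exists (take (size ps) (link_bits g)) => //.
rewrite in_cons; case: (boolP (g q1 q2 m)) => [gq|_]; last by rewrite eqxx.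
apply/orP; right.
rewrite ifT ?inE ?eqxx//; apply/allP => _ /mapP[k + ->] /=.
rewrite mem_filter mem_iota /= add0n => /andP[/andP[kq1 kq2] km].
rewrite /check /= hg//.
set x := nth _ _ _; set y := nth _ _ _.
have xP : x -> g q1 k m by apply: nth_link_take => //; rewrite eq_sym.
have yP : y -> g q2 k m by apply: nth_link_take => //; rewrite eq_sym.
have rot a b : g m a b = g a b m by rewrite s12 s23.
case: ifP => [gk|_].
  apply/andP; split; apply/negP.
  - by move=> /xP xx; have := k4 q1 q2 k m; rewrite gk gq xx.
  - by move=> /yP yy; have := k4 q2 q1 k m; rewrite !(s12 q2 q1) gk gq yy.
apply/negP => /andP[/xP xx /yP yy].
by have := k4 m q1 q2 k; rewrite !rot gq xx yy.
Qed.

Lemma sum_star g i : symmetric3 g -> i < m ->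
  count (nth false (link_bits g)) (star i) = \sum_(k <- iota 0 m) g i k m.
Proof.
move=> sg im; rewrite /star count_map -sum1_count big_filter_cond /= big_mkcond /=.
rewrite [LHS]big_seq [RHS]big_seq; apply: eq_bigr => k; rewrite mem_iota /= add0n => km.
case: eqVneq => [->|ki] /=; first by case: sg => _ _ ->.
by rewrite nth_link// 1?eq_sym//; case: (g i k m).
Qed.

Lemma degreeS g i : symmetric3 g ->
  degree m.+1 g i = degree m g i + (\sum_(k <- iota 0 m) g i k m + \sum_(k <- iota 0 m) g i k m).
Proof.
move=> [s12 s23 irr]; have irr' k a : g a k k = false by rewrite s12 s23 irr.
rewrite !degreeE -addn1 iotaD /= add0n big_cat big_seq1 /=.
under eq_bigr do rewrite big_cat big_seq1 /=.
rewrite big_split /= big_cat big_seq1 /= irr' addn0 -addnA; congr (_ + (_ + _)).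
by apply: eq_bigr => k _; rewrite s23.
Qed.

Lemma degree_last g : symmetric3 g ->
  degree m.+1 g m = \sum_(i <- iota 0 m) \sum_(k <- iota 0 m) g i k m.
Proof.
move=> sg; rewrite degreeS//; have [s12 s23 irr] := sg.
have -> : \sum_(k <- iota 0 m) g m k m = 0.
  by rewrite big1// => k _; rewrite s23 irr.
rewrite !addn0 !degreeE; apply: eq_bigr => i _; apply: eq_bigr => k _.
by rewrite s12 s23.
Qed.

Lemma extsP g : good g -> (forall i, i < m -> degree m.+1 g m <= degree m.+1 g i) ->
  bits m.+1 g \in exts (bits m g).
Proof.
move=> gg gmin; have [sg k4 f32] := gg; have [s12 s23 irr] := sg.
have hg := @dec_bits m g sg.
rewrite bitsS -/(link_bits g); apply: map_f; rewrite mem_filter linksP// andbT.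
apply/andP; split.
  rewrite /min_last; set I := [seq count _ _ | s <- _].
  have EI : I = [seq \sum_(k <- iota 0 m) g i k m | i <- iota 0 m].
    rewrite /I -map_comp; apply/eq_in_map => i; rewrite mem_iota /= => im.
    exact: sum_star.
  rewrite EI sumnE big_map -degree_last//.
  apply/allP => d /(nthP (0, 0))[i]; rewrite size_zip !size_map size_iota minnn => im <-.
  rewrite nth_zip ?size_map//= !(nth_map 0) ?size_iota// nth_iota// add0n.
  suff -> : degree m (dec m (bits m g)) i = degree m g i by rewrite -degreeS//; exact: gmin.
  rewrite !degreeE big_seq [RHS]big_seq; apply: eq_bigr => j; rewrite mem_iota /= => jm.
  rewrite big_seq [RHS]big_seq; apply: eq_bigr => k; rewrite mem_iota /= => km.
  by rewrite hg.
apply/allP => s; rewrite mem_cat => /orP[] /flatten_mapP.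
  case=> -[[a b] c]; rewrite mem_filter mem_triples => /andP[/= hab /and3P[ab bc cm]].
  move=> /mapP[d]; rewrite mem_filter mem_iota /= => /andP[/andP[/andP[da db] dc] dm] ->.
  have bm := ltn_trans bc cm; have am := ltn_trans ab bm.
  rewrite /= !nth_link// andbT; rewrite hg// in hab.
  by have := f32 d m a b c; rewrite hab andbT !(s23 d m).
case=> -[a b]; rewrite mem_pairs => /andP[ab bm].
move=> /mapP[[c d]]; rewrite mem_filter mem_pairs /= => /andP[/andP[gc gd] /andP[cd dm]] ->.
have am := ltn_trans ab bm; have cm := ltn_trans cd dm.
rewrite !hg// in gc gd; rewrite /= !nth_link ?(ltn_eqF ab) ?(ltn_eqF cd)// andbT.
by have := f32 a b c d m; rewrite gc gd.
Qed.

End Extensions.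

(** * Representatives up to isomorphism *)

Definition edge_count (c : seq bool) : nat := count id c.

(** Comparing edge counts first keeps the search over all permutations to a short list. *)
Definition covered (n : nat) (ps : seq (seq nat)) (acc : seq (seq bool)) (x : seq bool) :=
  let k := edge_count x in let acc' := [seq a <- acc | edge_count a == k] in
  let g := dec n x in has (fun p => bits n (pull g p) \in acc') ps.

Definition add_rep (n : nat) (ps : seq (seq nat)) (acc : seq (seq bool)) (x : seq bool) :=
  if covered n ps acc x then acc else x :: acc.

Definition next_reps (m : nat) (R : seq (seq bool)) : seq (seq bool) :=
  let ps := perms m.+1 in
  foldl (add_rep m.+1 ps) [::] (flatten [seq exts m c | c <- R]).

Fixpoint reps (m : nat) : seq (seq bool) :=
  if m is m'.+1 then next_reps m' (reps m') else [:: [::]].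

Lemma next_repsP m R g : symmetric3 g ->
  bits m.+1 g \in flatten [seq exts m c | c <- R] ->
  exists2 p, is_perm m.+1 p & bits m.+1 (pull g p) \in next_reps m R.
Proof.
move=> sg; rewrite /next_reps.
have : forall p, p \in perms m.+1 -> is_perm m.+1 p by move=> p; rewrite mem_perms.
move: (perms m.+1) (flatten _) => ps s psP.
have mono t acc x : x \in acc -> x \in foldl (add_rep m.+1 ps) acc t.
  elim: t acc => //= y t IH acc xa; apply: IH; rewrite /add_rep; case: ifP => // _.
  by rewrite inE xa orbT.
elim: s [::] => //= x s IH acc; rewrite inE => /orP[/eqP ex|]; last exact: IH.
have dx : agree m.+1 (dec m.+1 x) g by rewrite -ex; exact: dec_bits.
have bx p : is_perm m.+1 p -> bits m.+1 (pull (dec m.+1 x) p) = bits m.+1 (pull g p).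
  by move=> pp; apply/bits_agree/(agree_pull dx (is_perm_lt pp) (is_perm_size pp)).
rewrite {2}/add_rep; case: ifP => [/hasP[p pps]|_].
  have pp := psP p pps; rewrite bx// mem_filter => /andP[_ pa].
  by exists p => //; exact: mono.
exists (iota 0 m.+1); first exact: perm_refl.
apply: mono; rewrite inE (_ : bits _ _ = x) ?eqxx// -ex.
exact/bits_agree/pull_iota.
Qed.

(** A vertex of minimum degree is moved to the end by [t], and the other [m] vertices are then
    arranged into a representative. *)
Lemma reps_ext m g : good g ->
  (forall h, good h -> exists2 p, is_perm m p & bits m (pull h p) \in reps m) ->
  exists p, [/\ is_perm m.+1 p, bits m (pull g p) \in reps m
    & bits m.+1 (pull g p) \in exts m (bits m (pull g p))].
Proof.
move=> gg IH.
have [v vm vmin] : exists2 v, v < m.+1 & forall i, i < m.+1 -> degree m.+1 g v <= degree m.+1 g i.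
  have [v _ vmin] := @arg_minnP 'I_m.+1 ord0 xpredT (degree m.+1 g) isT.
  by exists v => // i im; exact: (vmin (Ordinal im)).
pose t := rcons (rem v (iota 0 m.+1)) v.
have tp : is_perm m.+1 t.
  rewrite /is_perm /t perm_rcons perm_sym; apply: perm_to_rem.
  by rewrite mem_iota.
have st : size (rem v (iota 0 m.+1)) = m by rewrite size_rem ?mem_iota// size_iota.
have [p pp pR] := IH _ (good_pull t gg).
(* This permutation fixes the last index, so the vertex of minimum degree stays last. *)
have qp : is_perm m.+1 (rcons p m).
  by rewrite /is_perm -addn1 iotaD /= add0n -cats1 perm_cat2r.
pose r := comp_idx t (rcons p m); have rp : is_perm m.+1 r by exact: is_perm_comp.
have ag : agree m.+1 (pull g r) (pull (pull g t) (rcons p m)).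
  by apply: pull_comp; exact: is_perm_size.
have nr i : i < m -> nth 0 (rcons p m) i = nth 0 p i.
  by move=> im; rewrite nth_rcons (is_perm_size pp) im.
have bm : bits m (pull g r) = bits m (pull (pull g t) p).
  apply: bits_agree => i j k im jm km.
  by rewrite ag ?ltnS ?(ltnW im) ?(ltnW jm) ?(ltnW km)// /pull !nr.
exists r; split=> //; first by rewrite bm.
apply: extsP; first exact: good_pull.
move=> i im; rewrite !degree_pull//; apply: leq_trans (_ : degree m.+1 g v <= _).
  suff -> : nth 0 r m = v by [].
  rewrite (nth_map 0) ?size_rcons ?(is_perm_size pp)// nth_rcons (is_perm_size pp) ltnn eqxx.
  by rewrite /t nth_rcons st ltnn eqxx.
by apply: vmin; apply: (allP (is_perm_lt rp)); rewrite mem_nth// (is_perm_size rp); lia.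
Qed.

Lemma repsP m g : good g -> exists2 p, is_perm m p & bits m (pull g p) \in reps m.
Proof.
elim: m g => [|m IH] g gg; first by exists [::].
have [p [pp pR pe]] := reps_ext gg IH.
have [q qp qR] : exists2 q, is_perm m.+1 q & bits m.+1 (pull (pull g p) q) \in reps m.+1.
  apply: next_repsP; first by apply: symmetric3_pull; case: gg.
  by apply/flatten_mapP; exists (bits m (pull g p)).
exists (comp_idx p q); first exact: is_perm_comp.
by rewrite (bits_agree (pull_comp g p (is_perm_size qp))).
Qed.

(** * The certificate *)

(* The solution of the semidefinite program, rounded to integers.  In each group,
   [codes] lists the flags used, by their edges; [comb] lists combinations of their
   coordinates that vanish in the blow-up of the design; [mat] is the lower triangle
   of the form, and [chol] the nonzero part of an approximate Cholesky factor. *)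
Definition codesN : seq (seq (nat * nat * nat)) := [::
  [:: (0,1,3)]; [:: (0,1,3); (1,2,3)]; [:: (0,1,3); (0,1,4)];
  [:: (0,1,3); (0,2,3); (0,1,4)]; [:: (1,2,3); (0,1,4)]; [:: (0,1,3); (0,3,4)];
  [:: (0,1,3); (1,2,3); (0,3,4)]; [:: (1,2,3); (0,1,4); (0,3,4)];
  [:: (0,1,3); (1,2,3); (1,2,4)]; [:: (0,1,3); (1,2,3); (0,1,4); (1,2,4)];
  [:: (0,1,3); (1,2,3); (1,2,4); (0,3,4)]; [:: (0,1,3); (1,3,4)];
  [:: (0,2,3); (1,3,4)]; [:: (0,1,3); (0,2,3); (1,3,4)]; [:: (1,2,3); (1,3,4)];
  [:: (0,1,3); (1,2,3); (1,3,4)]; [:: (0,2,3); (0,1,4); (1,3,4)];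
  [:: (1,2,3); (0,1,4); (1,3,4)]; [:: (0,2,3); (1,2,3); (0,1,4); (1,3,4)];
  [:: (0,2,3); (0,2,4); (1,3,4)]; [:: (0,2,3); (1,2,3); (0,1,4); (0,2,4); (1,3,4)];
  [:: (1,2,3); (0,3,4); (1,3,4)]; [:: (0,2,3); (1,2,3); (0,3,4); (1,3,4)];
  [:: (1,2,3); (0,2,4); (0,3,4); (1,3,4)]].

Definition codesE : seq (seq (nat * nat * nat)) := [::
  [:: (0,1,2)]; [:: (0,1,2); (0,1,3)]; [:: (0,1,2); (0,1,3); (0,1,4)];
  [:: (0,1,2); (0,2,3); (0,1,4)]; [:: (0,1,2); (0,3,4)];
  [:: (0,1,2); (0,2,3); (0,1,4); (0,3,4)]; [:: (0,1,2); (1,2,3); (0,1,4); (0,3,4)];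
  [:: (0,1,2); (0,3,4); (1,3,4)]; [:: (0,1,2); (0,2,3); (0,3,4); (1,3,4)];
  [:: (0,1,2); (1,2,3); (0,2,4); (0,3,4); (1,3,4)]].

Definition codesP : seq (seq (nat * nat * nat)) := [::
  [:: (0,1,2); (0,1,3); (0,1,4); (0,2,5)];
  [:: (0,1,2); (0,1,3); (0,1,4); (0,2,5); (0,3,5); (0,4,5)];
  [:: (0,1,2); (0,1,3); (0,1,4); (1,2,5); (0,3,5); (0,4,5)];
  [:: (0,1,2); (0,1,3); (0,1,4); (0,2,5); (2,3,5)];
  [:: (0,1,2); (0,1,3); (0,1,4); (0,2,5); (2,3,5); (0,4,5)];
  [:: (0,1,2); (0,1,3); (0,1,4); (1,2,5); (2,3,5); (0,4,5)];
  [:: (0,1,2); (0,1,3); (0,1,4); (0,2,5); (2,3,5); (2,4,5)];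
  [:: (0,1,2); (0,1,3); (0,1,4); (0,3,5); (2,3,5); (0,4,5); (2,4,5)];
  [:: (0,1,2); (0,1,3); (0,1,4); (1,2,5); (0,3,5); (2,3,5); (2,4,5)];
  [:: (0,1,2); (0,1,3); (0,1,4); (1,2,5); (0,3,5); (2,3,5); (0,4,5); (2,4,5)]].

Definition codesD : seq (seq (nat * nat * nat)) := [::
  [::]; [:: (0,1,2); (0,1,3)]; [:: (0,1,2); (1,2,3)]].

Section Data.
Local Open Scope Z_scope.

Definition combN : seq (seq (nat * Z)) := [::
  [:: (0%N, 1)]; [:: (1%N, 1)]; [:: (2%N, 1)]; [:: (3%N, 1)]; [:: (4%N, 1)];
  [:: (5%N, 1)]; [:: (6%N, 1)]; [:: (7%N, 1)]; [:: (8%N, 1)]; [:: (10%N, 1)];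
  [:: (11%N, 1)]; [:: (12%N, 1)]; [:: (13%N, 1)]; [:: (14%N, 1)];
  [:: (9%N, -1); (15%N, 1)]; [:: (16%N, 1)]; [:: (17%N, 1)]; [:: (18%N, 1)];
  [:: (19%N, 1)]; [:: (20%N, 1)]; [:: (21%N, 1)]; [:: (9%N, 1); (22%N, 1)];
  [:: (23%N, 1)]].

Definition matN : seq (seq Z) := [::
  [:: 2449];
  [:: 612; 2274];
  [:: 2347; 1438; 4347];
  [:: 5943; 4935; 8552; 26803];
  [:: 2763; 1310; 2275; 7886; 13609];
  [:: 908; 1055; 650; 3899; 1029; 1147];
  [:: 922; 868; 1270; 2903; 3764; 109; 1770];
  [:: 3157; 787; -423; 10066; 2217; 2836; 381; 18401];
  [:: 1916; -810; 1938; 4686; 980; -179; 759; 4324; 4532];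
  [:: -734; -1871; -7220; -6224; -5630; 2524; -4401; 14051; -2485; 31485];
  [:: 1443; 924; 3054; 6850; 875; 519; 444; 162; 1638; -4597; 2590];
  [:: -2547; -2776; -1787; -8045; -12837; -2016; -4002; -3155; 1461; 1988; 193; 17203];
  [:: -120; -3477; 1985; -1969; -12991; -2029; -2555; -765; 5267; -1932; 2015; 12736;
    30511];
  [:: 2694; 532; 2206; 9364; 2131; 1501; 418; 8016; 3516; 2712; 2114; -1099; 1496; 5345];
  [:: 1726; -2024; 1877; 2399; 2721; -674; 442; 547; 3643; -3347; 1520; 291; 4826; 2351;
    5524];
  [:: -1931; -325; -778; 568; -1793; -526; -1299; -1075; 327; -1628; 1130; 5936; -1448;
    440; 90; 8410];
  [:: 350; 1119; 3390; 8349; 4237; -1295; 3117; 388; 5344; -17061; 3312; 1143; 351; 2465;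
    2764; 6625; 20282];
  [:: 1268; -1441; 1033; 3115; -1571; 552; -1864; 2278; 1790; 4561; 1680; 3905; 4468;
    3038; 3224; 1962; -2504; 5994];
  [:: -1556; -1406; -2912; -7727; -3893; 31; -2518; -2716; -3682; 9183; -2198; 1709; 738;
    -2647; -1526; -1613; -10942; 1764; 7033];
  [:: 990; -2191; 1248; -343; 1793; -1126; 317; -1511; 2794; -4047; 895; 881; 4906; 886;
    4806; -186; 2124; 2291; -870; 4544];
  [:: 508; 1464; 1305; -2318; 326; -21; 1183; -5816; -2797; -4416; -712; -4334; -944;
    -3497; -2317; -6642; -5492; -3625; 1830; -1257; 8920];
  [:: 2335; -405; 3146; 6234; 3811; 116; 1046; 876; 3098; -4923; 2353; -1684; 2248; 2813;
    4265; -185; 3381; 2476; -2466; 3411; -1154; 4222];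
  [:: 796; -298; 456; -69; -948; 702; -1111; -898; -1310; 4224; 116; -519; 1380; 1; 348;
    -2473; -7323; 2459; 3808; 280; 2181; 363; 3645]].

Definition cholN : seq (seq Z) := [::
  [:: 24734; 6186; 23723; 60070; 27928; 9178; 9319; 31910; 19366; -7419; 14585; -25744;
    -1213; 27230; 17446; -19518; 3538; 12817; -15728; 10007; 5135; 23602; 8046];
  [:: 23016; 9244; 37459; 6723; 8993; 6924; -28; -14003; -18329; 6116; -23234; -37441;
    -1540; -26674; 1716; 11204; -19097; -11045; -26488; 14522; -10742; -5399];
  [:: 20929; 17521; -7450; -6610; 1549; -41210; 7383; -69738; 17246; 18096; 41622; -3834;
    14427; 12072; 31535; 6246; -12079; 15264; 3354; 15572; -1288];
  [:: 37170; 4643; 5445; -3243; 35586; 10852; 21473; 8207; 2380; 6830; 22333; 8022;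
    27943; 24281; 16539; -9729; 1021; -40104; 7272; -7418];
  [:: 49995; -2681; 13217; -16180; -3942; -33929; -2787; -44210; -53680; -6993; 8853;
    910; 20149; -13052; -10092; 9118; 1033; 8963; -8012];
  [:: 6373; -8976; -14621; -18425; 30603; 428; -11088; -10262; -4161; -2090; -5917;
    -51264; 17001; 30989; -2408; 9470; -571; 25202];
  [:: 6248; 9591; 2672; -544; -4273; -21646; 33103; -825; 79; -23680; -4458; -13468;
    -1239; 1108; 13355; -1311; -848];
  [:: 7022; 3119; 2082; -560; 3321; -2495; 2309; 44; 1789; 5579; -656; -3891; -485;
    -3557; -323; -3347];
  [:: 4149; -6587; 1535; 11560; -11287; 1642; 446; 10529; 13858; 1469; -7041; 35; -7461;
    587; -5653];
  [:: 4414; -256; -2758; 4381; 111; 1105; -3121; -5914; 1446; 3045; 1012; 1387; 599; 2803];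
  [:: 1767; 3787; -5749; 656; -244; 4015; 2340; 1673; -950; -398; -2680; 93; -825];
  [:: 7203; -11720; 657; -1309; 6526; 4252; 1790; -2170; -1432; -3802; -691; -1791];
  [:: 6240; 149; 1348; -993; -684; 554; 791; 1335; -55; 785; 533];
  [:: 1611; 571; 431; 321; 375; -30; 350; -595; 326; 37];
  [:: 2021; 586; 107; 961; 303; 528; -910; 741; 325];
  [:: 3308; 2205; 316; -367; 189; -2467; -105; -968];
  [:: 2636; -644; -943; -167; -816; -273; -1056];
  [:: 1774; 228; 655; -421; 324; 258];
  [:: 1662; -5; -82; -92; 193];
  [:: 1846; -362; 950; 93];
  [:: 1849; 175; 204];
  [:: 1063; 89];
  [:: 1614]].

Definition combE : seq (seq (nat * Z)) := [::
  [:: (0%N, 1)]; [:: (1%N, 1)]; [:: (2%N, 1); (9%N, -4)]; [:: (3%N, 1)]; [:: (4%N, 1)];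
  [:: (5%N, 1); (9%N, -3)]; [:: (6%N, 1)]; [:: (7%N, 1)]; [:: (8%N, 1)]].

Definition matE : seq (seq Z) := [::
  [:: 30];
  [:: 79; 602];
  [:: -63; -391; 270];
  [:: -256; -1031; 711; 3593];
  [:: 54; 148; -8; -850; 1562];
  [:: -3; 545; -305; -315; 76; 826];
  [:: -295; -1361; 937; 3044; -772; -801; 3833];
  [:: -33; 472; -242; -655; 42; 742; -461; 1053];
  [:: 35; 1347; -732; -1461; 878; 1860; -2311; 1773; 4574]].

Definition cholE : seq (seq Z) := [::
  [:: 5450; 14496; -11560; -46974; 9909; -550; -54131; -6055; 6422];
  [:: 19788; -11291; -17690; 221; 27945; -29125; 28289; 63367];
  [:: 2929; -10847; 37225; 1421; -6009; 2528; 19702];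
  [:: 30911; 748; 5465; -2561; -13315; 5673];
  [:: 8786; 2083; -410; 1322; 7139];
  [:: 2871; 2260; 5067; 6571];
  [:: 2524; 2102; 1262];
  [:: 507; -656];
  [:: 754]].

Definition combP : seq (seq (nat * Z)) := [::
  [:: (0%N, 1)]; [:: (1%N, 1)]; [:: (2%N, 1)]; [:: (3%N, 1)]; [:: (4%N, 1)];
  [:: (5%N, 1)]; [:: (6%N, 1)]; [:: (7%N, 1)]; [:: (8%N, 1)]; [:: (9%N, 1)]].

Definition matP : seq (seq Z) := [::
  [:: 279];
  [:: -36; 501];
  [:: 110; 1017; 2574];
  [:: 867; 1443; 3445; 7711];
  [:: 1453; 3373; 7803; 15910; 33535];
  [:: -501; -782; -741; -4771; -9519; 6479];
  [:: 1132; 216; 1478; 4607; 8448; -1811; 5116];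
  [:: 734; 1377; 3814; 6770; 14234; -2389; 4421; 6885];
  [:: -487; 2565; 4990; 6365; 15502; -3547; -189; 6111; 13545];
  [:: -206; 2467; 5020; 7047; 16533; -3818; 955; 6733; 12734; 12237]].

Definition cholP : seq (seq Z) := [::
  [:: 8344; -1079; 3296; 25976; 43533; -15010; 33916; 21991; -14591; -6172];
  [:: 11134; 23155; 34918; 79955; -19013; 8136; 33050; 56181; 54796];
  [:: 9816; -3350; -4492; 31018; 7064; 11792; -540; 664];
  [:: 4731; 8403; -7400; 2183; 1422; 1423; 2310];
  [:: 2200; -2069; -717; -154; 1966; 1932];
  [:: 3409; 1933; 1663; -1829; -1408];
  [:: 1866; 418; -2040; -1800];
  [:: 1084; 355; 223];
  [:: 1753; 1058];
  [:: 1575]].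

Definition combD : seq (seq (nat * Z)) := [::
  [:: (1%N, 1); (2%N, -1)]; [:: (0%N, 5); (1%N, -12); (2%N, -12)]].

Definition matD : seq (seq Z) := [::
  [:: 1586];
  [:: 56; 2]].

Definition cholD : seq (seq Z) := [::
  [:: 19912; 703];
  [:: 26]].

End Data.

Definition code (m : nat) (l : seq (nat * nat * nat)) : seq bool :=
  [seq t \in l | t <- triples m].

Definition dense (n : nat) (l : seq (nat * Z)) : seq Z :=
  mkseq (fun i => sumZ [seq q.2 | q <- l & q.1 == i]) n.

Definition symm (rows : seq (seq Z)) : seq (seq Z) :=
  let n := size rows in
  mkseq (fun i => mkseq (fun j => entry rows (maxn i j) (minn i j)) n) n.

Definition pad (rows : seq (seq Z)) : seq (seq Z) :=
  mkseq (fun i => nseq i Z0 ++ nth [::] rows i) (size rows).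

Definition mkblock (s e : nat) (G : seq (seq nat * bool))
    (C : seq (seq (nat * nat * nat))) (O : seq (seq (nat * Z))) (M : seq (seq Z)) : block :=
  Block s e G [seq code (s + e) c | c <- C] [seq dense (size C) o | o <- O] (symm M).

Definition cats (A B : seq (seq nat)) : seq (seq nat) := [seq a ++ b | a <- A, b <- B].

Definition unsigned (A : seq (seq nat)) : seq (seq nat * bool) := [seq (a, false) | a <- A].

Definition Sym (i n : nat) : seq (seq nat) := permutations (iota i n).

(** Four roots and no further vertex: the two flags coincide, and [psi] is the square of one
    coordinate. This expresses the objective in the same format as the squares. *)
Definition blockA : block := mkblock 4 0 (unsigned (Sym 0 4))
  [:: [:: (0, 1, 2); (0, 1, 3)]] [:: [:: (0, Zpos xH)]] [:: [:: Zpos xH]].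

(** The coordinates change sign when roots 1 and 2 are exchanged and are symmetric in the two
    further vertices. *)
Definition blockN : block := mkblock 3 2
  [:: ([:: 0; 1; 2; 3; 4], false); ([:: 0; 1; 2; 4; 3], false);
      ([:: 0; 2; 1; 3; 4], true); ([:: 0; 2; 1; 4; 3], true)] codesN combN matN.

Definition blockE : block :=
  mkblock 3 2 (unsigned (cats (Sym 0 3) (Sym 3 2))) codesE combE matE.

Definition blockP : block := mkblock 5 1
  ([seq ([:: 0; 1] ++ c ++ [:: 5], false) | c <- Sym 2 3] ++
   [seq ([:: 1; 0] ++ c ++ [:: 5], true) | c <- Sym 2 3]) codesP combP matP.

Definition blockD : block :=
  mkblock 1 3 (unsigned (cats [:: [:: 0]] (Sym 1 3))) codesD combD matD.

(** Ordering the values inside each interchangeable group of indices, and the first values of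
    exchangeable groups, selects one permutation from each coset. *)
Definition increasing (l : seq (nat * nat)) : seq (seq nat) :=
  [seq p <- perms 7 | all (fun q => nth 0 p q.1 < nth 0 p q.2) l].

Definition reprA := increasing [:: (0, 1); (1, 2); (2, 3); (4, 5); (5, 6)].
Definition reprN := increasing [:: (1, 2); (3, 4); (5, 6); (3, 5)].
Definition reprE := increasing [:: (0, 1); (1, 2); (3, 4); (5, 6); (3, 5)].
Definition reprP := increasing [:: (0, 1); (2, 3); (3, 4); (5, 6)].
Definition reprD := increasing [:: (1, 2); (2, 3); (4, 5); (5, 6); (1, 4)].

Definition swap_pairs : seq (seq nat) :=
  cats (Sym 3 2) (Sym 5 2) ++ cats (Sym 5 2) (Sym 3 2).

Definition stabA := cats (Sym 0 4) (Sym 4 3).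
Definition stabN := cats [:: [:: 0; 1; 2]; [:: 0; 2; 1]] swap_pairs.
Definition stabE := cats (Sym 0 3) swap_pairs.
Definition stabP := cats (Sym 0 2) (cats (Sym 2 3) (Sym 5 2)).
Definition stabD :=
  cats [:: [:: 0]] (cats (Sym 1 3) (Sym 4 3) ++ cats (Sym 4 3) (Sym 1 3)).

Definition well_formed (B : block) : bool :=
  [&& block_ok B, group_ok B, inverse_ok B & bs B + (be B + be B) <= 7].

(** Base 7 digits. Distinct keys force distinct permutations, so sorting integers replaces the
    pairwise comparison of 5040 lists. *)
Definition key (p : seq nat) : Z :=
  foldr (fun i k => Z.add (Z.of_nat i) (Z.mul 7 k)) Z0 p.

Definition transversalb (B : block) (P St : seq (seq nat)) : bool :=
  [&& all (stab_ok B) St, all (is_perm 7) St, size P * size St == 7`! &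
     sorted Z.ltb (sort Z.leb [seq key (comp_idx p q) | p <- P, q <- St])].

(** The products are distinct permutations and there are 7! of them, hence they are all the
    permutations. *)
Lemma transversalbP B l St : transversalb B (increasing l) St ->
  transversal B (increasing l) St.
Proof.
move=> /and4P[sok /allP S7 /eqP sz srt]; rewrite /transversal.
set P := increasing l in sz srt *.
have P7 p : p \in P -> is_perm 7 p by rewrite mem_filter mem_perms => /andP[].
have U : uniq [seq comp_idx p q | p <- P, q <- St].
  apply: (@map_uniq _ _ key); rewrite map_allpairs -(sort_uniq Z.leb).
  apply: sorted_uniq srt; last by move=> x; rewrite Z.ltb_irrefl.
  by move=> y x z /Z.ltb_lt xy /Z.ltb_lt yz; apply/Z.ltb_lt/(Z.lt_trans _ _ _ xy yz).
have L7 : all (is_perm 7) [seq comp_idx p q | p <- P, q <- St].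
  apply/allP => _ /allpairsP[[p q] /= [pP qS ->]].
  by apply: is_perm_comp; [exact: P7|exact: S7].
have S0 : St != [::] by apply: contra_eq_neq sz => ->; rewrite muln0.
have PS : perm_eq [seq comp_idx p q | p <- P, q <- St] (perms 7).
  by apply: (perm_eq_perms L7 U); rewrite size_allpairs.
by apply/and5P; split=> //; apply/allP.
Qed.

Lemma wfA : well_formed blockA. Proof. by vm_compute. Qed.
Lemma wfN : well_formed blockN. Proof. by vm_compute. Qed.
Lemma wfE : well_formed blockE. Proof. by vm_compute. Qed.
Lemma wfP : well_formed blockP. Proof. by vm_compute. Qed.
Lemma wfD : well_formed blockD. Proof. by vm_compute. Qed.

Lemma trA : transversalb blockA reprA stabA. Proof. by vm_compute. Qed.
Lemma trN : transversalb blockN reprN stabN. Proof. by vm_compute. Qed.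
Lemma trE : transversalb blockE reprE stabE. Proof. by vm_compute. Qed.
Lemma trP : transversalb blockP reprP stabP. Proof. by vm_compute. Qed.
Lemma trD : transversalb blockD reprD stabD. Proof. by vm_compute. Qed.
Lemma psdN : psd_cert 23 500 (pad cholN) (bM blockN). Proof. by vm_compute. Qed.
Lemma psdE : psd_cert 9 1000 (pad cholE) (bM blockE). Proof. by vm_compute. Qed.
Lemma psdP : psd_cert 10 500 (pad cholP) (bM blockP). Proof. by vm_compute. Qed.
Lemma psdD : psd_cert 2 500 (pad cholD) (bM blockD). Proof. by vm_compute. Qed.

Definition tabA := table blockA.
Definition tabN := table blockN.
Definition tabE := table blockE.
Definition tabP := table blockP.
Definition tabD := table blockD.

(* With [add] and the table lookups abstract, [value_of] evaluated on 35 boolean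
   variables is a sum without any graph lookup: [value35_of].  This keeps the check
   below feasible for the lazy reduction machine as well. *)
Section Value.
Variables (add : Z -> Z -> Z) (zero : Z) (lk : block -> seq bool -> seq bool -> Z).

Definition vsum_of (B : block) (P : seq (seq nat)) (g : hyp) : Z :=
  foldr add zero [seq lk B (bits (bs B + be B) (pull g (comp_idx p (ext1 B))))
                           (bits (bs B + be B) (pull g (comp_idx p (ext2 B)))) | p <- P].
End Value.

Definition value_of (add : Z -> Z -> Z) (zero : Z) (lkA lkN lkE lkP lkD : seq bool -> seq bool -> Z)
    (g : hyp) : Z :=
  add (vsum_of add zero (fun=> lkA) blockA reprA g)
  (add (vsum_of add zero (fun=> lkN) blockN reprN g)
  (add (vsum_of add zero (fun=> lkE) blockE reprE g)
  (add (vsum_of add zero (fun=> lkP) blockP reprP g)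
       (vsum_of add zero (fun=> lkD) blockD reprD g)))).

Fixpoint curried (n : nat) : Type := if n is n'.+1 then bool -> curried n' else Z.

Fixpoint uncurry (n : nat) : curried n -> seq bool -> Z :=
  match n with
  | 0 => fun f _ => f
  | n'.+1 => fun f c => @uncurry n' (f (head false c)) (behead c)
  end.

Definition value35_of (add : Z -> Z -> Z) (zero : Z)
    (lkA lkN lkE lkP lkD : seq bool -> seq bool -> Z) : curried 35 :=
  Eval cbv in
  fun b0 b1 b2 b3 b4 b5 b6 b7 b8 b9 b10 b11 b12 b13 b14 b15 b16 b17 b18 b19 b20 b21 b22
    b23 b24 b25 b26 b27 b28 b29 b30 b31 b32 b33 b34 =>
  value_of add zero lkA lkN lkE lkP lkD (dec 7
   [:: b0; b1; b2; b3; b4; b5; b6; b7; b8; b9; b10; b11; b12; b13; b14; b15; b16; b17;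
       b18; b19; b20; b21; b22; b23; b24; b25; b26; b27; b28; b29; b30; b31; b32; b33;
       b34]).

Lemma seq35_ind (P : seq bool -> Prop) :
  (forall b0 b1 b2 b3 b4 b5 b6 b7 b8 b9 b10 b11 b12 b13 b14 b15 b16 b17 b18 b19 b20 b21 b22
    b23 b24 b25 b26 b27 b28 b29 b30 b31 b32 b33 b34,
   P [:: b0; b1; b2; b3; b4; b5; b6; b7; b8; b9; b10; b11; b12; b13; b14; b15; b16; b17;
     b18; b19; b20; b21; b22; b23; b24; b25; b26; b27; b28; b29; b30; b31; b32; b33;
     b34]) ->
  forall c, size c = 35 -> P c.
Proof. by move=> IH c; do 35 (case: c => [//|? c]); case: c => // _; exact: IH. Qed.

Lemma value35E add zero lkA lkN lkE lkP lkD c : size c = 35 ->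
  uncurry (value35_of add zero lkA lkN lkE lkP lkD) c
  = value_of add zero lkA lkN lkE lkP lkD (dec 7 c).
Proof.
move: c; apply: seq35_ind => *.
reflexivity.
Qed.

(** Isomorphs are rejected up to six points only; among the extensions to seven points this search
    would cost more than evaluating duplicates. *)
Definition all_exts (f : seq bool -> bool) : bool := all (fun c => all f (exts 6 c)) (reps 6).

Definition certificate : curried 35 :=
  value35_of Z.add Z0 (fun x y => Z.mul 405 (look2 tabA x y)) (look2 tabN) (look2 tabE) (look2 tabP) (look2 tabD).

Lemma check_value : all_exts (fun c => Z.leb (uncurry certificate c) 126000).
Proof. vm_cast_no_check (erefl true). Qed.

(** * The upper bound *)

Lemma vsum_scale k T B P g :
  vsum_of Z.add Z0 (fun _ x y => Z.mul k (look2 T x y)) B P g = Z.mul k (vsum B T P g).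
Proof.
rewrite /vsum_of /vsum; elim: P => [|p P IH] /=; first by rewrite Z.mul_0_r.
by rewrite IH Z.mul_add_distr_l.
Qed.

Lemma all_increasing l : all (is_perm 7) (increasing l).
Proof. by apply/allP => p; rewrite mem_filter mem_perms => /andP[]. Qed.

Lemma vsum_orbit B l St g p : well_formed B -> transversalb B (increasing l) St ->
  symmetric3 g -> is_perm 7 p ->
  vsum B (table B) (increasing l) (dec 7 (bits 7 (pull g p))) =
  orbit_sum B (increasing l) g.
Proof.
move=> /and4P[ok gok iok m7] /transversalbP tr sg pp.
rewrite vsumE//; [|exact: symmetric3_pull|exact: all_increasing].
exact: orbit_sum_pull tr pp.
Qed.

Section UpperBound.
Local Open Scope ring_scope.

(** Orbit sums are invariant under relabelling, so [g] may be replaced by the enumerated extension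
    isomorphic to it. *)
Lemma orbit_sums_le g : good g ->
  Zpos 405 * orbit_sum blockA reprA g + (orbit_sum blockN reprN g + (orbit_sum blockE reprE g
    + (orbit_sum blockP reprP g + orbit_sum blockD reprD g))) <= Zpos 126000 :> Z.
Proof.
move=> gg; have [sg _ _] := gg.
have [p [pp cR xe]] := reps_ext gg (fun h => @repsP 6 h).
have /allP/(_ _ cR)/allP/(_ _ xe) := check_value.
have -> : uncurry certificate (bits 7 (pull g p)) =
    Z.add (Z.mul 405 (orbit_sum blockA reprA g)) (Z.add (orbit_sum blockN reprN g)
    (Z.add (orbit_sum blockE reprE g) (Z.add (orbit_sum blockP reprP g)
    (orbit_sum blockD reprD g)))).
  apply: etrans (value35E _ _ _ _ _ _ _ _) _; first by rewrite size_bits.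
  apply: (f_equal2 Z.add); last apply: (f_equal2 Z.add); last apply: (f_equal2 Z.add);
    last apply: (f_equal2 Z.add).
  - apply: etrans (vsum_scale _ _ _ _ _) _; apply: (f_equal (Z.mul 405)).
    exact: vsum_orbit wfA trA sg pp.
  - exact: vsum_orbit wfN trN sg pp.
  - exact: vsum_orbit wfE trE sg pp.
  - exact: vsum_orbit wfP trP sg pp.
  - exact: vsum_orbit wfD trD sg pp.
move: (orbit_sum blockA _ _) (orbit_sum blockN _ _)
  (orbit_sum blockE _ _) (orbit_sum blockP _ _) (orbit_sum blockD _ _) => a b c d e.
exact: id.
Qed.

Lemma sum_le_of_pointwise (I : finType) (a b c d e : I -> Z) (k K : Z) :
  (forall i, k * a i + (b i + (c i + (d i + e i))) <= K) ->
  0 <= \sum_i b i -> 0 <= \sum_i c i -> 0 <= \sum_i d i -> 0 <= \sum_i e i ->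
  k * \sum_i a i <= K *+ #|I|.
Proof.
move=> H b0 c0 d0 e0; rewrite -sumr_const; apply: le_trans (ler_sum _ (fun i _ => H i)).
by rewrite !big_split /= -mulr_sumr lerDl !addr_ge0.
Qed.

Section TupleBound.
Variables (V : finType) (x0 : V) (E : V -> V -> V -> bool).
Hypothesis goodE : forall t, good (idx x0 E t).

Lemma size_reprA : size reprA = 35%N.
Proof. by vm_compute. Qed.

Lemma sum_orbit_ge0 B P : well_formed B -> (bs B + (be B + be B) == 7)%N ->
  all (is_perm 7) P -> (exists k L, psd_cert (size (bO B)) k L (bM B)) ->
  0 <= \sum_(t : 7.-tuple V) orbit_sum B P (idx x0 E t).
Proof.
move=> /and4P[ok _ _ m7] /eqP e7 P7 [k [L psd]].
rewrite sum_orbit_sum//; apply: mulrn_wge0; rewrite -e7.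
apply: sum_psi_ge0 => // x; have /and3P[_ sq sy] := ok.
exact: psd_certP sq sy psd.
Qed.

Lemma sum_psiA_le :
  Zpos 405 * ((\sum_(t : 7.-tuple V) psi blockA (idx x0 E t)) *+ 35)
  <= Zpos 126000 *+ (#|V| ^ 7) :> Z.
Proof.
have /and4P[okA _ _ A7] := wfA.
have EA : (\sum_(t : 7.-tuple V) psi blockA (idx x0 E t)) *+ 35 =
    \sum_(t : 7.-tuple V) orbit_sum blockA reprA (idx x0 E t).
  by rewrite -size_reprA; apply: esym; apply: sum_orbit_sum => //; exact: all_increasing.
have posN : 0 <= \sum_(t : 7.-tuple V) orbit_sum blockN reprN (idx x0 E t).
  apply: sum_orbit_ge0 wfN _ (all_increasing _) _ => //; do 2 eexists; exact: psdN.
have posE : 0 <= \sum_(t : 7.-tuple V) orbit_sum blockE reprE (idx x0 E t).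
  apply: sum_orbit_ge0 wfE _ (all_increasing _) _ => //; do 2 eexists; exact: psdE.
have posP : 0 <= \sum_(t : 7.-tuple V) orbit_sum blockP reprP (idx x0 E t).
  apply: sum_orbit_ge0 wfP _ (all_increasing _) _ => //; do 2 eexists; exact: psdP.
have posD : 0 <= \sum_(t : 7.-tuple V) orbit_sum blockD reprD (idx x0 E t).
  apply: sum_orbit_ge0 wfD _ (all_increasing _) _ => //; do 2 eexists; exact: psdD.
rewrite EA -[(#|V| ^ 7)%N]card_tuple.
by apply: sum_le_of_pointwise posN posE posP posD => t; exact: orbit_sums_le.
Qed.
End TupleBound.

Lemma psdA : psd_cert (size (bO blockA)) (Zpos xH) [::] (bM blockA).
Proof. by vm_compute. Qed.

Lemma psiA_ge0 g : 0 <= psi blockA g.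
Proof.
have /and4P[ok _ _ _] := wfA; have /and3P[_ sq sy] := ok.
have -> : psi blockA g =
    bform (bM blockA) (lins blockA (pull g (iota 0 4))) (lins blockA (pull g (iota 0 4))).
  by [].
by apply: psd_certP sq sy psdA _; rewrite size_map.
Qed.

Lemma stabA_perms : all (stab_ok blockA) (perms 4).
Proof. by vm_compute. Qed.

Definition code42 : seq bool := [:: true; true; false; false].

(** The coordinate is 4, one for each automorphism of 4.2, and the form squares it. *)
Lemma psiA_code42 : psi blockA (dec 4 code42) = Zpos 16.
Proof. by vm_compute. Qed.

Section QuadrupleCount.
Variables (V : finType) (x0 : V) (E : V -> V -> V -> bool).
Hypothesis goodE : forall t, good (idx x0 E t).

Lemma psiA_permute (w : seq V) p : is_perm 4 p -> bits 4 (idx x0 E w) = code42 ->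
  psi blockA (idx x0 E (permute x0 p w)) = Zpos 16.
Proof.
move=> pp ew; have /and4P[ok gok _ _] := wfA; have [sg _ _] := goodE w.
have ps : stab_ok blockA p by apply: (allP stabA_perms); rewrite mem_perms.
rewrite (psi_agree ok (@idx_permute _ x0 E p w 4 (is_perm_size pp))).
rewrite (psi_stab ok _ gok ps) -psiA_code42 -ew.
exact: (psi_agree ok (agree_sym (@dec_bits 4 _ sg))).
Qed.

Lemma psiA_uniq (u w : 4.-tuple V) : uniq u -> uniq w -> u =i w ->
  bits 4 (idx x0 E w) = code42 -> psi blockA (idx x0 E u) = Zpos 16.
Proof.
move=> uu uw e ew.
have pe : perm_eq u w by apply: uniq_perm.
pose p := [seq index x w | x <- u].
have -> : (u : seq V) = permute x0 p w.
  rewrite /permute /p -map_comp -[LHS]map_id; apply/eq_in_map => x xu /=.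
  by rewrite nth_index// -e.
apply: psiA_permute ew; rewrite /is_perm /p.
apply: perm_trans (perm_map _ pe) _.
have -> : [seq index x w | x <- w] = iota 0 4; last exact: perm_refl.
apply: (@eq_from_nth _ 0%N); rewrite ?size_map ?size_iota ?size_tuple// => i i4.
by rewrite (nth_map x0) ?size_tuple// nth_iota// add0n index_uniq ?size_tuple.
Qed.

Lemma sum_psiA_tuples :
  \sum_(t : 7.-tuple V) psi blockA (idx x0 E t) =
  (\sum_(u : 4.-tuple V) psi blockA (idx x0 E u)) *+ (#|V| ^ 3).
Proof.
have /and4P[ok _ _ _] := wfA.
rewrite (sum_tuple_cat 4 3 (fun t => psi blockA (idx x0 E t))) -sumrMnl.
apply: eq_bigr => u _; rewrite -(card_tuple 3 V) -sumr_const.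
apply: eq_bigr => v _; apply: (psi_agree ok) => i j k i4 j4 k4.
by rewrite /idx !nth_cat size_tuple i4 j4 k4.
Qed.

(** Each set has 24 orderings of value 16, whence 384; the remaining tuples contribute
    nonnegatively. *)
Lemma card_le_sum_psiA (F : {set {set V}}) :
  (forall S, S \in F -> exists w : 4.-tuple V,
     [/\ uniq w, [set x in w] = S & bits 4 (idx x0 E w) = code42]) ->
  Zpos 384 *+ #|F| <= \sum_(u : 4.-tuple V) psi blockA (idx x0 E u).
Proof.
move=> FP; pose Q (u : 4.-tuple V) := uniq u && ([set x in u] \in F).
apply: (@le_trans _ _ (\sum_(u : 4.-tuple V | Q u) psi blockA (idx x0 E u))); last first.
  by rewrite [leRHS](bigID Q) /= lerDl sumr_ge0// => u _; exact: psiA_ge0.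
rewrite (partition_big (fun u : 4.-tuple V => [set x in u]) (mem F)) /=; last first.
  by move=> u /andP[].
rewrite -sumr_const; apply: ler_sum => S SF; have [w [uw wS ew]] := FP S SF.
rewrite (eq_bigr (fun=> Zpos 16)); last first.
  move=> u /andP[/andP[uu _] /eqP uS]; apply: (psiA_uniq uu uw _ ew) => x.
  by have := erefl (x \in S); rewrite -{1}uS -wS !inE.
have cS : #|S| = 4%N by rewrite -wS cardsE; have /card_uniqP -> := uw; rewrite size_tuple.
rewrite sumr_const.
have -> : #|[pred u : 4.-tuple V | Q u && ([set x in u] == S)]| = 24%N; last by [].
have <- : (#|S| ^_ 4)%N = 24%N by rewrite cS.
rewrite -card_uniq_tuples; apply: eq_card => u.
rewrite !inE /Q; case: (boolP (uniq u)) => uu; rewrite ?andbT ?andbF//=.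
apply/andP/idP => [[_ /eqP uS]|/allP uS].
  apply/allP => x xu; have : x \in [set y in u] by rewrite inE.
  by rewrite uS.
have e : [set x in u] = S.
  apply/eqP; rewrite eqEcard cS cardsE.
  have -> : #|u| = 4%N by have /card_uniqP -> := uu; rewrite size_tuple.
  by rewrite leqnn andbT; apply/subsetP => x; rewrite inE => /uS.
by rewrite e eqxx SF.
Qed.

Lemma card_quadruples_le (F : {set {set V}}) :
  (forall S, S \in F -> exists w : 4.-tuple V,
     [/\ uniq w, [set x in w] = S & bits 4 (idx x0 E w) = code42]) ->
  (216 * #|F| <= 5 * #|V| ^ 4)%N.
Proof.
move=> FP; have := sum_psiA_le goodE; rewrite sum_psiA_tuples => H.
have := card_le_sum_psiA FP; set S := \sum_(u : _) _ in H * => H'.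
have n0 : (0 < #|V|)%N by apply/card_gt0P; exists x0.
(* 405 * 384 * 35 = 216 * 25200 and 126000 = 5 * 25200; what remains is to cancel the cube of the
   order. *)
have : Zpos 405 * ((Zpos 384 *+ #|F| *+ (#|V| ^ 3)) *+ 35) <= Zpos 126000 *+ (#|V| ^ 7).
  apply: le_trans H; rewrite ler_pM2l// lerMn2r/= lerMn2r; apply/orP; right; exact: H'.
have n3 : (#|V| ^ 7 = #|V| ^ 4 * #|V| ^ 3)%N by rewrite -expnD.
rewrite n3 -mulrnA -mulrnA; have : (0 < #|V| ^ 3)%N by rewrite expn_gt0 n0.
move: (#|V| ^ 3)%N (#|V| ^ 4)%N #|F| => a b c a0.
have EZ (x : Z) n : x *+ n = Z.mul x (Z.of_nat n).
  by elim: n => [|n IH]; rewrite ?mulr0n ?mulrS ?IH /GRing.add /GRing.zero /=; lia.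
rewrite !EZ => /Z.leb_le; rewrite !Nat2Z.inj_mul -[GRing.mul]/Z.mul => Hab.
suff : Z.le (Z.mul 216 (Z.of_nat c)) (Z.mul 5 (Z.of_nat b)) by lia.
by apply: (Zmult_le_reg_r _ _ (Z.of_nat a)); lia.
Qed.
End QuadrupleCount.
End UpperBound.

(** * 3-graphs as symmetric ternary relations *)

Section Triples.
Variable V : finType.

Lemma card_set3 (x y z : V) :
  (#|[set x; y; z]| == 3) = [&& x != y, x != z & y != z].
Proof.
rewrite -setUA cardsU1 cards2 !inE negb_or.
by case: (x == y); case: (x == z); case: (y == z).
Qed.

Lemma edge_card (G : graph3 V) e : e \in edges G -> #|e| = 3.
Proof. by move=> eG; exact/eqP/(implyP (forallP (edges_uniform3 G) e)). Qed.

Definition adj (G : graph3 V) (x y z : V) : bool := [set x; y; z] \in edges G.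

Lemma adj_uniq (G : graph3 V) x y z : adj G x y z -> [&& x != y, x != z & y != z].
Proof. by move=> /edge_card /eqP; rewrite card_set3. Qed.

Lemma symmetric3_adj (G : graph3 V) x0 t : symmetric3 (idx x0 (adj G) t).
Proof.
split=> [i j k|i j k|i k]; rewrite /idx /adj.
- by rewrite [[set nth x0 t i; _]]setUC.
- by rewrite setUAC.
- by apply/negP => /adj_uniq; rewrite eqxx.
Qed.

Lemma imset_vset k (f : 'I_k -> V) (F : nat -> V) a b c :
  (forall i, f i = F i) -> a < k -> b < k -> c < k ->
  f @: vset k [:: a; b; c] = [set F a; F b; F c].
Proof.
move=> fF ak bk ck; apply/setP => x; apply/imsetP/idP => [[i]|].
  by rewrite !inE fF => /or3P[]/eqP -> ->; rewrite eqxx ?orbT.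
rewrite !inE => /orP[/orP[]|]/eqP ->.
- by exists (Ordinal ak); rewrite ?fF// inE /= inE eqxx.
- by exists (Ordinal bk); rewrite ?fF// !inE /= eqxx orbT.
- by exists (Ordinal ck); rewrite ?fF// !inE /= eqxx !orbT.
Qed.

Lemma mem_list_edges k l (e : {set 'I_k}) :
  (e \in list_edges k l) = (e \in [seq vset k s | s <- l]).
Proof. by rewrite inE. Qed.

Lemma vset_eq k s s' :
  (vset k s == vset k s') = all (fun i => (i \in s) == (i \in s')) (iota 0 k).
Proof.
apply/eqP/allP => [/setP e i|e].
  by rewrite mem_iota add0n => ik; have := e (Ordinal ik); rewrite !inE /= => ->.
by apply/setP => i; rewrite !inE; apply/eqP/e; rewrite mem_iota /=.
Qed.

Lemma nth_ord_inj n (w : seq V) x0 : uniq w -> size w = n ->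
  injective (fun i : 'I_n => nth x0 w i).
Proof.
by move=> uw sw i j /eqP; rewrite nth_uniq ?sw// => /eqP /val_inj.
Qed.

(** From right to left, the embedding is injective because each pair of the four vertices lies in
    one of the three edges. *)
Lemma contains_K4minus (G : graph3 V) :
  contains G K4minus <-> exists a b c d, [&& adj G a b c, adj G a b d & adj G a c d].
Proof.
split=> [[f _ fE]|[a [b [c [d /and3P[h1 h2 h3]]]]]].
  exists (f (inord 0)), (f (inord 1)), (f (inord 2)), (f (inord 3)).
  have fF i : f i = f (inord i) by rewrite inord_val.
  rewrite /adj -!(imset_vset (F := fun i => f (inord i)) fF)//.
  by rewrite !fE//= mem_list_edges !inE eqxx ?orbT.
have /and3P[ab ac bc] := adj_uniq h1; have /and3P[_ ad bd] := adj_uniq h2.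
have /and3P[_ _ cd] := adj_uniq h3.
exists (fun i : 'I_4 => nth a [:: a; b; c; d] i).
  by apply: nth_ord_inj => //=; rewrite !inE !negb_or ab ac ad bc bd cd.
move=> e; rewrite mem_list_edges !inE => /or3P[] /eqP ->;
  by rewrite (imset_vset (F := nth a [:: a; b; c; d])).
Qed.

Lemma contains_F32 (G : graph3 V) : contains G F32 <->
  exists a b c d e, [&& adj G a b c, adj G a b d, adj G a b e & adj G c d e].
Proof.
split=> [[f _ fE]|[a [b [c [d [e /and4P[h1 h2 h3 h4]]]]]]].
  exists (f (inord 0)), (f (inord 1)), (f (inord 2)), (f (inord 3)), (f (inord 4)).
  have fF i : f i = f (inord i) by rewrite inord_val.
  rewrite /adj -!(imset_vset (F := fun i => f (inord i)) fF)//.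
  by rewrite !fE//= mem_list_edges !inE eqxx ?orbT.
have /and3P[ab ac bc] := adj_uniq h1; have /and3P[_ ad bd] := adj_uniq h2.
have /and3P[_ ae be] := adj_uniq h3; have /and3P[cd ce de] := adj_uniq h4.
exists (fun i : 'I_5 => nth a [:: a; b; c; d; e] i).
  by apply: nth_ord_inj => //=; rewrite !inE !negb_or ab ac ad ae bc bd be cd ce de.
move=> s; rewrite mem_list_edges !inE => /or4P[] /eqP ->;
  by rewrite (imset_vset (F := nth a [:: a; b; c; d; e])).
Qed.

Lemma isomorphic_g42 (G : graph3 V) x0 (S : {set V}) :
  (#|S| == 4) && `[< isomorphic (induced G S) g42 >] ->
  exists w : 4.-tuple V,
    [/\ uniq w, [set x in w] = S & bits 4 (idx x0 (adj G) w) = code42].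
Proof.
move=> /andP[/eqP cS /asboolP[f [h fK hK] fE]].
pose F i : V := val (h (inord i)).
have hF (i : 'I_4) : val (h i) = F i by rewrite /F inord_val.
pose w := [tuple of map F (iota 0 4)].
have inj_w (i j : 'I_4) : val (h i) = val (h j) -> i = j.
  by move=> /val_inj /(can_inj hK).
have uw : uniq w.
  rewrite map_inj_in_uniq ?iota_uniq// => i j; rewrite !mem_iota /= => i4 j4 e.
  have := inj_w (Ordinal i4) (Ordinal j4); rewrite !hF => /(_ e).
  by move=> /(congr1 val).
exists w; split=> //.
  apply/eqP; rewrite eqEcard cS cardsE.
  have /card_uniqP -> := uw; rewrite size_tuple leqnn andbT.
  apply/subsetP => x; rewrite inE => /mapP[i _ ->]; exact: valP.
have key a b c : a < 4 -> b < 4 -> c < 4 ->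
    adj G (F a) (F b) (F c) = (vset 4 [:: a; b; c] \in edges g42).
  move=> a4 b4 c4; rewrite /adj -(imset_vset hF a4 b4 c4).
  have -> : (fun i => val (h i)) @: vset 4 [:: a; b; c] =
      [set val x | x in h @: vset 4 [:: a; b; c]] by rewrite -imset_comp.
  have := fE (h @: vset 4 [:: a; b; c]); rewrite [in RHS]inE => <-.
  by rewrite -imset_comp (eq_imset (g := id)) ?imset_id// => i /=; rewrite hK.
by rewrite /bits /= /idx /= !key// /edges /= !mem_list_edges !inE !vset_eq.
Qed.

Lemma good_adj (G : graph3 V) x0 t : is_free [set pack3 K4minus; pack3 F32]%classic G ->
  good (idx x0 (adj G) t).
Proof.
move=> fG; split=> [|a b c d|a b c d e]; first exact: symmetric3_adj.
  apply/negP => h; apply: (fG (pack3 K4minus)); first by left.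
  by apply/contains_K4minus; do 4 eexists; exact: h.
apply/negP => h; apply: (fG (pack3 F32)); first by right.
by apply/contains_F32; do 5 eexists; exact: h.
Qed.

Lemma induced_count_le (G : graph3 V) : is_free [set pack3 K4minus; pack3 F32]%classic G ->
  216 * induced_count g42 G <= 5 * #|V| ^ 4.
Proof.
move=> fG; rewrite /induced_count; set F := [set S | _].
have [x0 _|V0] := pickP (fun _ : V => true).
  apply: (card_quadruples_le (fun t => @good_adj G x0 t fG)) => S.
  by rewrite inE card_ord => SF; exact: isomorphic_g42.
suff -> : F = set0 by rewrite cards0.
apply/setP => S; rewrite !inE card_ord; apply/negbTE/nandP; left.
by rewrite eq_card0// => x; have := V0 x.
Qed.
End Triples.

(** * The lower bound *)

Lemma isomorphic_g42_of (V : finType) (G : graph3 V) x0 (w : 4.-tuple V) :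
  uniq w -> bits 4 (idx x0 (adj G) w) = code42 ->
  (#|[set x in w]| == 4) && `[< isomorphic (induced G [set x in w]) g42 >].
Proof.
move=> uw; rewrite /bits /= /idx /= => -[e012 e013 e023 e123].
set S := [set x in w]; have cS : #|S| = 4.
  by rewrite cardsE; have /card_uniqP -> := uw; rewrite size_tuple.
rewrite cS eqxx /=; apply/asboolP.
have wS (i : 'I_4) : nth x0 w i \in S by rewrite inE mem_nth// size_tuple.
pose h (i : 'I_4) : {x : V | x \in S} := exist _ (nth x0 w i) (wS i).
have h_inj : injective h.
  by move=> i j /(congr1 val) /= /nth_ord_inj; apply => //; rewrite size_tuple.
have h_bij : bijective h.
  by apply: inj_card_bij => //; rewrite card_ord card_sig (eq_card (B := mem S)) ?cS.
have [f hK fK] := h_bij; exists f; first by exists h.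
move=> e; have -> : e = h @: (f @: e).
  by rewrite -imset_comp -[LHS]imset_id; apply: eq_imset => x /=; rewrite fK.
rewrite -[in LHS]imset_comp (eq_imset (g := id)) ?imset_id; last by move=> x /=; rewrite hK.
move: (f @: e) => {}e; rewrite [RHS]inE -imset_comp.
have g_inj : injective (fun i : 'I_4 => nth x0 w i).
  by apply: nth_ord_inj; rewrite ?size_tuple.
have -> : (val \o h) @: e = (fun i : 'I_4 => nth x0 w i) @: e by apply: eq_imset.
have [e3|ne3] := eqVneq #|e| 3; last first.
  apply/idP/idP => [/edge_card|/edge_card] H; case/eqP: ne3 => //.
  by move: H; rewrite card_imset.
(* A triple among four points is the complement of a point, so four cases remain, one for each bit
   of [code42]. *)
have [i ei] : exists i, e = ~: [set i].
  have /eqP/cards1P[i ei] : #|~: e| = 1 by have := cardsC e; rewrite card_ord e3; lia.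
  by exists i; rewrite -ei setCK.
have -> : e = vset 4 [seq j <- iota 0 4 | j != i :> nat].
  apply/setP => j; rewrite ei !inE mem_filter mem_iota /= ltn_ord andbT.
  by rewrite -val_eqE.
by move: (i) => [[|[|[|[|//]]]] i4] /=; rewrite mem_list_edges !inE !vset_eq /=
  (imset_vset (F := nth x0 w)) //; symmetry.
Qed.

Section GraphOf.
Variables (V : finType) (H : V -> V -> V -> bool).
Hypotheses (H12 : forall x y z, H x y z = H y x z) (H23 : forall x y z, H x y z = H x z y).
Hypothesis Hirr : forall x z, H x x z = false.

Definition edges_of : {set {set V}} :=
  [set e | [exists x, exists y, exists z, (e == [set x; y; z]) && H x y z]].

Lemma H_uniq x y z : H x y z -> [&& x != y, x != z & y != z].
Proof.
move=> h; apply/and3P; split; apply: contraTneq h => ->; first by rewrite Hirr.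
  by rewrite H23 Hirr.
by rewrite H12 H23 Hirr.
Qed.

Fact edges_of_uniform3 : uniform3 edges_of.
Proof.
apply/forallP => e; apply/implyP; rewrite inE.
move=> /existsP[x /existsP[y /existsP[z /andP[/eqP -> /H_uniq h]]]].
by rewrite card_set3.
Qed.

Definition graph_of : graph3 V := Graph3 edges_of_uniform3.

Lemma adj_graph_of x y z : adj graph_of x y z = H x y z.
Proof.
rewrite /adj inE; apply/idP/idP => [|h]; last first.
  by apply/existsP; exists x; apply/existsP; exists y; apply/existsP; exists z; rewrite eqxx.
move=> /existsP[a /existsP[b /existsP[c /andP[/eqP e h]]]].
have : #|[set x; y; z]| == 3 by rewrite e card_set3 H_uniq.
rewrite card_set3 => /and3P[xy xz yz].
have xe : x \in [set a; b; c] by rewrite -e !inE eqxx.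
have ye : y \in [set a; b; c] by rewrite -e !inE eqxx orbT.
have ze : z \in [set a; b; c] by rewrite -e !inE eqxx orbT.
move: xe ye ze xy xz yz; rewrite !inE.
do 3 (case/orP => [/orP[]|] /eqP ->); rewrite ?eqxx// => _ _ _.
- by rewrite H23.
- by rewrite H12.
- by rewrite H23 H12.
- by rewrite H12 H23.
- by rewrite H12 H23 H12.
Qed.
End GraphOf.

(* The 2-(6,3,2) design. *)
Definition h6 (i j k : nat) : bool :=
  sort3 i j k \in [:: (0, 1, 2); (0, 1, 3); (0, 2, 4); (1, 3, 4); (2, 3, 4);
                      (1, 2, 5); (0, 3, 5); (2, 3, 5); (0, 4, 5); (1, 4, 5)].

Lemma h6_12 i j k : h6 i j k = h6 j i k.
Proof. by rewrite /h6 (_ : sort3 i j k = sort3 j i k)// /sort3; congr (_, _, _); lia. Qed.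

Lemma h6_23 i j k : h6 i j k = h6 i k j.
Proof. by rewrite /h6 (_ : sort3 i j k = sort3 i k j)// /sort3; congr (_, _, _); lia. Qed.

Definition six := iota 0 6.

Lemma mod6 i : i %% 6 \in six.
Proof. by rewrite mem_iota add0n ltn_mod. Qed.

Lemma h6_irr : all (fun i => all (fun k => ~~ h6 i i k) six) six.
Proof. by vm_compute. Qed.

Lemma h6_K4minus_free : all (fun a => all (fun b => all (fun c => all (fun d =>
  ~~ [&& h6 a b c, h6 a b d & h6 a c d]) six) six) six) six.
Proof. by vm_compute. Qed.

Lemma h6_F32_free : all (fun a => all (fun b => all (fun c => all (fun d => all (fun e =>
  ~~ [&& h6 a b c, h6 a b d, h6 a b e & h6 c d e]) six) six) six) six) six.
Proof. by vm_compute. Qed.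

Definition quads : seq (seq nat) :=
  [seq s <- iter 4 (fun L => [seq a :: s | a <- six, s <- L]) [:: [::]]
  | has (fun p => bits 4 (pull (fun i j k => h6 (nth 0 s i) (nth 0 s j) (nth 0 s k)) p)
      == code42) (perms 4)].

(** Each of the 15 four-sets of points of the design spans exactly two edges, giving 15 * 24 = 360
    patterns. Doubling one vertex of one of the 10 edges gives 10 * 3 * 12 = 360 more. *)
Lemma size_quads : size quads = 720.
Proof. by vm_compute. Qed.

Lemma quads_ok :
  uniq quads && all (fun s => (size s == 4) && all (fun i => i < 6) s) quads.
Proof. by vm_compute. Qed.

Section BlowUp.
Variable n : nat.

Definition blow (x y z : 'I_n) : bool := h6 (x %% 6) (y %% 6) (z %% 6).

Lemma blow_12 x y z : blow x y z = blow y x z. Proof. exact: h6_12. Qed.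
Lemma blow_23 x y z : blow x y z = blow x z y. Proof. exact: h6_23. Qed.
Lemma blow_irr x z : blow x x z = false.
Proof. by apply/negbTE/(allP (allP h6_irr _ (mod6 x)) _ (mod6 z)). Qed.

Definition blow_up : graph3 'I_n := graph_of blow_12 blow_23 blow_irr.

Lemma blow_up_free : is_free [set pack3 K4minus; pack3 F32]%classic blow_up.
Proof.
move=> F [->|->] /=.
  move=> /contains_K4minus[a [b [c [d]]]]; rewrite !adj_graph_of; apply/negP.
  exact: (allP (allP (allP (allP h6_K4minus_free _ (mod6 a)) _ (mod6 b)) _ (mod6 c)) _ (mod6 d)).
move=> /contains_F32[a [b [c [d [e]]]]]; rewrite !adj_graph_of; apply/negP.
exact: (allP (allP (allP (allP (allP h6_F32_free _ (mod6 a)) _ (mod6 b)) _ (mod6 c)) _ (mod6 d))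
  _ (mod6 e)).
Qed.

Definition quad_tuple (u : 4.-tuple 'I_n) : bool := [seq nat_of_ord x %% 6 | x <- u] \in quads.

Lemma quad_tuple_g42 (u : 4.-tuple 'I_n) : uniq u -> quad_tuple u ->
  (#|[set x in u]| == 4) && `[< isomorphic (induced blow_up [set x in u]) g42 >].
Proof.
move=> uu; have x0 : 'I_n := thead u.
rewrite /quad_tuple mem_filter => /andP[/hasP[p]]; rewrite mem_perms => pp /eqP e _.
have sw : size (permute x0 p u) == 4 by rewrite size_map (is_perm_size pp).
have pw : perm_eq (Tuple sw) u.
  rewrite /= /permute -[X in perm_eq _ X](mkseq_nth x0) size_tuple.
  exact: perm_map.
have -> : [set x in u] = [set x in Tuple sw].
  by apply/setP => x; rewrite !inE (perm_mem pw).
apply: (@isomorphic_g42_of _ _ x0); first by rewrite (perm_uniq pw).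
rewrite -e; apply: bits_agree => i j k i4 j4 k4.
have p4 l : l < 4 -> nth 0 p l < size u.
  move=> l4; rewrite size_tuple; apply: (allP (is_perm_lt pp)).
  by rewrite mem_nth// (is_perm_size pp).
rewrite /idx adj_graph_of /blow /pull.
by rewrite !(nth_map 0) ?(is_perm_size pp)// !(nth_map x0) ?p4.
Qed.

Let F := [set S : {set 'I_n} |
  (#|S| == #|'I_4|) && `[< isomorphic (induced blow_up S) g42 >]].

Lemma card_uniq_quads :
  #|[set u : 4.-tuple 'I_n | uniq u && quad_tuple u]| <= 24 * #|F|.
Proof.
rewrite -sum1_card (partition_big (fun u : 4.-tuple 'I_n => [set x in u]) (mem F)) /=; last first.
  by move=> u; rewrite inE => /andP[uu qu]; rewrite inE card_ord quad_tuple_g42.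
rewrite mulnC -sum_nat_const; apply: leq_sum => S; rewrite inE card_ord => /andP[/eqP cS _].
rewrite sum1dep_card; have <- : (#|S| ^_ 4)%N = 24 by rewrite cS.
rewrite -card_uniq_tuples; apply: subset_leq_card; apply/subsetP => u.
rewrite !inE => /andP[/andP[uu _] /eqP uS]; rewrite uu andbT.
apply/allP => x xu; have : x \in [set y in u] by rewrite inE.
by rewrite uS.
Qed.

Lemma card_nonuniq : #|[set u : 4.-tuple 'I_n | ~~ uniq u]| = n ^ 4 - n ^_ 4.
Proof.
have := card_uniq_tuples 4 (mem 'I_n); rewrite card_ord => <-.
have <- : #|[set: 4.-tuple 'I_n]| = n ^ 4 by rewrite cardsT card_tuple card_ord.
rewrite -(cardsID [set u : 4.-tuple 'I_n | uniq u] setT) setTI.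
have -> : [set t : 4.-tuple 'I_n | all (mem 'I_n) t & uniq t] = [set u : 4.-tuple 'I_n | uniq u].
  by apply/setP => u; rewrite !inE (_ : all _ _ = true)//; apply/allP.
rewrite addKn; apply: eq_card => u; by rewrite !inE andbT.
Qed.

(** Vertices are written 6a + c with a < n / 6, so each pattern of residues admits (n / 6)^4 tuples;
    the at most five vertices left over are ignored. *)
Lemma card_classes (Q : seq (seq nat)) :
  uniq Q -> all (fun s => (size s == 4) && all (fun i => i < 6) s) Q ->
  size Q * (n %/ 6) ^ 4 <=
  #|[set u : 4.-tuple 'I_n | [seq nat_of_ord x %% 6 | x <- u] \in Q]|.
Proof.
move=> Uq /allP okq.
case: (posnP (n %/ 6)) => [->|q0]; first by rewrite muln0.
have n0 : 0 < n by move: q0; case: (n).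
set q := n %/ 6; pose z0 := Ordinal n0.
have qm : 6 * q <= n by rewrite mulnC leq_trunc_div.
pose c (i : 'I_(size Q)) j := nth 0 (nth [::] Q i) j.
have inq (i : 'I_(size Q)) : nth [::] Q i \in Q by rewrite mem_nth.
have c6 i j : j < 4 -> c i j < 6.
  move=> j4; have /andP[/eqP s4 /allP] := okq _ (inq i); apply.
  by rewrite mem_nth// s4.
(* The default [z0] is never taken, as 6a + c < 6q <= n. *)
pose f (x : 'I_(size Q) * 4.-tuple 'I_q) : 4.-tuple 'I_n :=
  [tuple insubd z0 (6 * tnth x.2 j + c x.1 j) | j < 4].
have fE x (j : 'I_4) : tnth (f x) j = 6 * tnth x.2 j + c x.1 j :> nat.
  rewrite tnth_mktuple val_insubd ifT//; apply: leq_trans qm.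
  have := ltn_ord (tnth x.2 j); have := c6 x.1 j (ltn_ord j); lia.
have fmod x (j : 'I_4) : tnth (f x) j %% 6 = c x.1 j.
  by rewrite fE mulnC modnMDl modn_small ?c6.
have fq x : [seq nat_of_ord y %% 6 | y <- f x] = nth [::] Q x.1.
  have /andP[/eqP s4 _] := okq _ (inq x.1).
  apply: (@eq_from_nth _ 0); rewrite size_map size_tuple ?s4// => j j4.
  rewrite (nth_map z0) ?size_tuple// -[j]/(val (Ordinal j4)) -tnth_nth.
  exact: fmod.
have f_inj : injective f.
  move=> x y e; have e1 : x.1 = y.1.
    apply/val_inj/eqP; rewrite -(nth_uniq [::] (ltn_ord x.1) (ltn_ord y.1) Uq).
    by rewrite -!fq e.
  case: x y e e1 => [i v] [i' v'] e /= ei; rewrite -ei in e *.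
  congr (_, _); apply/eq_from_tnth => j.
  apply: val_inj; have := congr1 (fun t : 4.-tuple 'I_n => nat_of_ord (tnth t j)) e.
  by rewrite !fE /= => /addIn /eqP; rewrite eqn_pmul2l// => /eqP.
have -> : size Q * q ^ 4 = #|f @: setT|.
  by rewrite card_imset// cardsT card_prod card_tuple !card_ord.
apply: subset_leq_card; apply/subsetP => _ /imsetP[x _ ->].
by rewrite inE fq.
Qed.

Lemma card_quads : 720 * (n %/ 6) ^ 4 <= #|[set u : 4.-tuple 'I_n | quad_tuple u]|.
Proof. by rewrite -size_quads; have /andP[U ok] := quads_ok; exact: card_classes. Qed.

(** Tuples with a repeated vertex can have an admissible pattern, since patterns may repeat a class;
    all such tuples are discarded at once. *)
Lemma induced_count_blow_up :
  720 * (n %/ 6) ^ 4 <= 24 * induced_count g42 blow_up + (n ^ 4 - n ^_ 4).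
Proof.
apply: leq_trans card_quads _; rewrite -card_nonuniq.
apply: leq_trans (leq_add card_uniq_quads (leqnn _)).
rewrite -cardsUI; apply: leq_trans (leq_addr _ _); apply: subset_leq_card.
by apply/subsetP => u; rewrite !inE => ->; rewrite andbT orbN.
Qed.
End BlowUp.

(** * The limit *)

From mathcomp Require Import all_boot all_order all_algebra.
From mathcomp Require Import all_classical all_reals all_analysis.
From mathcomp Require Import lra.
Import numFieldNormedType.Exports.

Section Limit.
Let Fam := [set pack3 K4minus; pack3 F32]%classic.

Lemma ex_le n : 216 * ex g42 n Fam <= 5 * n ^ 4.
Proof.
rewrite mulnC -leq_divRL//; apply/bigmax_leqP => G /asboolP fG.
by rewrite leq_divRL// mulnC; have := induced_count_le fG; rewrite card_ord.
Qed.

Lemma ex_ge n : 720 * (n %/ 6) ^ 4 <= 24 * ex g42 n Fam + (n ^ 4 - n ^_ 4).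
Proof.
apply: leq_trans (induced_count_blow_up n) _; rewrite leq_add2r leq_mul2l /=.
by apply: leq_bigmax_cond; apply/asboolP; exact: blow_up_free.
Qed.

Local Open Scope ring_scope.

(** The constant 18 exceeds 100/9 + 6: the first term is the loss from rounding n / 6 down, the
    second that from tuples with a repeated vertex. *)
Lemma density_bound (R : realType) n : (12 <= n)%N ->
  `|density R g42 Fam n - 5%:R / 9%:R| <= 18%:R / n%:R.
Proof.
move=> n12; rewrite /density card_ord.
have nE : ('C(n, 4) * 24 = n ^_ 4)%N by rewrite -[24%N]/(4`!) bin_ffact.
have := ex_le n; have := ex_ge n; set e := ex _ _ _.
move: nE; set C := 'C(n, 4); set P := (n ^_ 4)%N; set q := (n %/ 6)%N => nE lo up.
have PE : P = (n * ((n - 1) * ((n - 2) * (n - 3))))%N.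
  by rewrite /P !ffactnS ffactn0 muln1 -!subn1 -!subnDA.
have qE : (n <= 6 * q + 5)%N by rewrite /q; lia.
have P1 : (P <= n ^ 4)%N by rewrite PE !expnS expn0 muln1; do !apply: leq_mul; lia.
(* P = n^4 - 6n^3 + 11n^2 - 6n; writing n as m + 4 removes the truncated subtractions. *)
have P2 : (n ^ 4 <= P + 6 * n ^ 3)%N.
  rewrite PE (_ : n = (n - 4).+4); last by lia.
  move: (n - 4)%N => m; rewrite !subSS !subn0 !expnS expn0; nia.
have P0 : (0 < P)%N by rewrite PE !muln_gt0; lia.
have C0 : (0 < C)%N by move: P0; rewrite -nE muln_gt0 => /andP[].
have upR : 216%:R * e%:R <= 5%:R * n%:R ^+ 4 :> R by rewrite -natrX -!natrM ler_nat.
have loR : 720%:R * q%:R ^+ 4 <= 24%:R * e%:R + (n%:R ^+ 4 - P%:R) :> R.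
  by rewrite -!natrX -natrB// -!natrM -natrD ler_nat.
have P1R : P%:R <= n%:R ^+ 4 :> R by rewrite -natrX ler_nat.
have P2R : n%:R ^+ 4 <= P%:R + 6%:R * n%:R ^+ 3 :> R.
  by rewrite -!natrX -natrM -natrD ler_nat.
have qER : n%:R <= 6%:R * q%:R + 5%:R :> R by rewrite -natrM -natrD ler_nat.
have nER : C%:R * 24%:R = P%:R :> R by rewrite -natrM nE.
have x12 : 12%:R <= n%:R :> R by rewrite ler_nat.
have C0R : 0 < C%:R :> R by rewrite ltr0n.
have q0 : 0 <= q%:R :> R by rewrite ler0n.
have e0 : 0 <= e%:R :> R by rewrite ler0n.
have P0R : 0 < P%:R :> R by rewrite ltr0n.
move: nER upR loR P1R P2R qER x12 C0R q0 e0 P0R.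
move: C%:R P%:R q%:R e%:R n%:R => {up lo P1 P2 qE nE PE P0 C0 n12}c p y f x nER up lo P1 P2 qE x12 c0 y0 f0 p0.
have x0 : 0 < x by lra.
have x30 : 0 < x ^+ 3 by rewrite exprn_gt0.
have x4 : x ^+ 4 = x * x ^+ 3 by rewrite exprS.
(* Here 720 / 6^4 = 5/9, and 6y >= x - 5 with (x - 5)^4 >= x^4 - 20x^3. *)
have y4 : 720%:R * y ^+ 4 >= 5%:R / 9%:R * (x ^+ 4 - 20%:R * x ^+ 3).
  have h : (x - 5%:R) ^+ 4 <= (6%:R * y) ^+ 4 by apply: lerXn2r; rewrite ?nnegrE; lra.
  have h' : x ^+ 4 - 20%:R * x ^+ 3 <= (x - 5%:R) ^+ 4.
    by rewrite -subr_ge0 [X in 0 <= X](_ : _ = x * (150%:R * x - 500%:R) + 625%:R); [nra|ring].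
  have -> : 720%:R * y ^+ 4 = 5%:R / 9%:R * (6%:R * y) ^+ 4 by field.
  by rewrite ler_pM2l; lra.
have cE : f / c = 24%:R * f / p.
  by rewrite -nER; field; rewrite gt_eqF.
rewrite cE ler_distl; apply/andP; split.
  rewrite ler_pdivlMr//.
  (* Bounding [p] by x^4 requires a nonnegative factor; for a nonpositive one the left side is at
     most 0. *)
  have [neg|pos] := lerP (5%:R / 9%:R - 18%:R / x) 0.
    apply: (@le_trans _ _ 0); last by lra.
    by apply: mulr_le0_ge0 neg (ltW p0).
  apply: le_trans (ler_wpM2l (ltW pos) P1) _.
  have -> : (5%:R / 9%:R - 18%:R / x) * x ^+ 4 = 5%:R / 9%:R * x ^+ 4 - 18%:R * x ^+ 3.
    by rewrite x4; field; rewrite gt_eqF.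
  by lra.
rewrite ler_pdivrMr//.
have w0 : 0 <= 5%:R / 9%:R + 18%:R / x by rewrite addr_ge0 ?divr_ge0 ?ltW//; lra.
(* The loss 10/3 x^3 + 108 x^2 is covered by 18 x^3, because x >= 12 gives 108 x^2 <= 9 x^3. *)
apply: le_trans (ler_wpM2l w0 (_ : x ^+ 4 - 6%:R * x ^+ 3 <= p)); last by lra.
have -> : (5%:R / 9%:R + 18%:R / x) * (x ^+ 4 - 6%:R * x ^+ 3) =
    5%:R / 9%:R * x ^+ 4 + (18%:R - 10%:R / 3%:R) * x ^+ 3 - 108%:R * x ^+ 2.
  by field; rewrite gt_eqF.
have x2 : 12%:R * x ^+ 2 <= x ^+ 3 by rewrite [x ^+ 3]exprS ler_pM2r ?exprn_gt0.
by lra.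
Qed.

Local Open Scope classical_set_scope.
Local Open Scope ring_scope.

Lemma density_cvg (R : realType) : density R g42 Fam @ \oo --> (5%:R / 9%:R : R).
Proof.
have h0 : (fun n => 36%:R * harmonic n : R) @ \oo --> (0 : R).
  by rewrite -[X in _ --> X](mulr0 36%:R); apply: cvgMr; exact: cvg_harmonic.
have lo : (fun n => 5%:R / 9%:R - 36%:R * harmonic n : R) @ \oo --> (5%:R / 9%:R : R).
  by rewrite -[X in _ --> X](subr0 _); apply: cvgB => //; exact: cvg_cst.
have up : (fun n => 5%:R / 9%:R + 36%:R * harmonic n : R) @ \oo --> (5%:R / 9%:R : R).
  by rewrite -[X in _ --> X](addr0 _); apply: cvgD => //; exact: cvg_cst.
apply: squeeze_cvgr lo up; near=> n.
have n12 : (12 <= n)%N by near: n; exact: nbhs_infty_ge.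
have := density_bound R n12; rewrite ler_distl => /andP[l u].
(* [harmonic n] is 1 / (n + 1), and n + 1 <= 2n accounts for the doubled constant. *)
have H : 18%:R / n%:R <= 36%:R * harmonic n :> R.
  have n0 : 0 < n%:R :> R by rewrite ltr0n; lia.
  rewrite /= ler_pdivrMr// mulrAC ler_pdivlMr ?ltr0n//.
  by rewrite -!natrM ler_nat; lia.
by apply/andP; split; [apply: le_trans l|apply: le_trans u _]; lra.
Unshelve. all: by end_near. Qed.
End Limit.

(** [limn] takes a default value on a divergent sequence, so convergence is asserted together with
    the value. *)
Theorem theorem2p14 (R : realType) :
  cvgn (density R g42 [set pack3 K4minus; pack3 F32]%classic) /\
  turan_density R g42 [set pack3 K4minus; pack3 F32]%classic = (5%:R / 9%:R)%R.
Proof.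
have h := @density_cvg R; split; first by apply/cvg_ex; exists (5%:R / 9%:R)%R.
exact/cvg_lim.
Qed.
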